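(* Let $B=R_{\mathbf p}(\mathbf t,\boldsymbol\sigma,\mathbf H,\mathbf J)$ be a BR algebra of rank $n$ over an algebra $R$. Suppose that each $\sigma_i$ is a locally algebraic automorphism of $R$. Then $\operatorname{GKdim}R\le\operatorname{GKdim}B\le\operatorname{GKdim}R+n$. Moreover, if each $J_i$ contains a normal element of $R$ which is not a zero divisor, or if each $H_i$ contains a normal element of $R$ which is not a zero divisor, then $\operatorname{GKdim}B=\operatorname{GKdim}R+n$. In particular, $\operatorname{GKdim}B=\operatorname{GKdim}R+n$ if $R$ is a commutative domain.
   Context: All algebras are associative unital algebras over a field $\Bbbk$; $\operatorname{GKdim}$ is Gelfand--Kirillov dimension; $[n]=\{1,\dots,n\}$. An automorphism $\sigma$ of $R$ is locally algebraic if for every $r\in R$ the set $\{\sigma^k(r):k\in\mathbb N\}$ is contained in a finite-dimensional subspace of $R$. An element $a\in R$ is normal if $aR=Ra$. A matrix $\mathbf p=(p_{ik})\in M_n(\Bbbk^\times)$ is multiplicatively antisymmetric if $p_{ik}=p_{ki}^{-1}$ for all $i,k$. BR algebra: given an algebra $R$, commuting automorphisms $\boldsymbol\sigma=(\sigma_1,\dots,\sigma_n)$ of $R$ and multiplicatively antisymmetric $\mathbf p$, let $R_{\mathbf p}[\mathbf t^{\pm1};\boldsymbol\sigma]$ be the iterated skew Laurent extension generated over $R$ by $t_1^{\pm1},\dots,t_n^{\pm1}$ with $t_i^{\pm1}r=\sigma_i^{\pm1}(r)t_i^{\pm1}$ for $r\in R$ and $t_kt_i=p_{ik}t_it_k$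 for $i\ne k$. Let $\mathbf H=(H_1,\dots,H_n)$, $\mathbf J=(J_1,\dots,J_n)$ be two-sided ideals of $R$. Put $I_i^{(k)}=J_i\sigma_i(J_i)\cdots\sigma_i^{k-1}(J_i)$ for $k>0$, $I_i^{(0)}=R$, $I_i^{(k)}=\sigma_i^{-1}(H_i)\sigma_i^{-2}(H_i)\cdots\sigma_i^{k}(H_i)$ for $k<0$. Assume that for $i\ne k$: $\sigma_i(H_k)=H_k$, $\sigma_i(J_k)=J_k$, $H_iH_k=H_kH_i$, $H_iJ_k=J_kH_i$, $J_iJ_k=J_kJ_i$; and $I_i^{(k)}\neq0$ for all $i\in[n]$, $k\in\mathbb Z$. The BR algebra of rank $n$ is the subalgebra $R_{\mathbf p}(\mathbf t,\boldsymbol\sigma,\mathbf H,\mathbf J)=\bigoplus_{\boldsymbol\alpha\in\mathbb Z^n}I_1^{(\alpha_1)}\cdots I_n^{(\alpha_n)}\,t_1^{\alpha_1}\cdots t_n^{\alpha_n}\subset R_{\mathbf p}[\mathbf t^{\pm1};\boldsymbol\sigma]$. *)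

(* Defs.v *)
From HB Require Import structures.
From mathcomp Require Import all_boot all_order all_algebra.
From mathcomp Require Import finmap.
From mathcomp Require Import all_classical all_reals all_analysis.
From mathcomp Require Import ring zify.

Set Implicit Arguments.
Unset Strict Implicit.
Unset Printing Implicit Defensive.

Import Order.TTheory GRing.Theory Num.Theory.

Local Open Scope classical_set_scope.
Local Open Scope ring_scope.

Section LinearAlgebra.
Context (k : fieldType) (V : lmodType k).

Definition lspan (S : set V) : set V :=
  [set v | exists m (c : 'I_m -> k) (w : 'I_m -> V),
     (forall i, S (w i)) /\ v = \sum_(i < m) c i *: w i].

Definition lin_indep d (e : 'I_d -> V) : Prop :=
  forall c : 'I_d -> k, \sum_(i < d) c i *: e i = 0 -> forall i, c i = 0.

Definition has_dim (W : set V) (d : nat) : Prop :=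
  exists e : 'I_d -> V, lin_indep e /\ W = lspan (range e).

Definition fin_dim (W : set V) : Prop := exists d, has_dim W d.

(* [0] when [W] is not a finite-dimensional subspace. *)
Definition ldim (W : set V) : nat := xget 0%N (has_dim W).

Lemma lspan_lin (S : set V) (c : k) v w :
  lspan S v -> lspan S w -> lspan S (c *: v + w).
Proof.
move=> [m [cv [ev [Sv ->]]]] [l [cw [ew [Sw ->]]]].
exists (m + l)%N.
exists (fun i => match fintype.split i with inl j => c * cv j | inr j => cw j end).
exists (fun i => match fintype.split i with inl j => ev j | inr j => ew j end).
split; first by move=> i; case: (fintype.split i).
rewrite big_split_ord /= scaler_sumr; congr (_ + _); apply: eq_bigr => i _.
  by case: (splitP (lshift l i)) => [j /= /val_inj ->|j /= ij];
    [rewrite scalerA|have := ltn_ord i; lia].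
case: (splitP (rshift m i)) => [j /= ij|j /= /eqP].
  by have := ltn_ord j; lia.
by rewrite eqn_add2l => /eqP /val_inj ->.
Qed.

Lemma lspan0 (S : set V) : lspan S 0.
Proof.
exists 0%N, (fun=> 0), (fun=> 0); split; first by case.
by rewrite big_ord0.
Qed.

Lemma lspan_gen (S : set V) v : S v -> lspan S v.
Proof.
move=> Sv; exists 1%N, (fun=> 1), (fun=> v); split => //.
by rewrite big_ord1 scale1r.
Qed.

End LinearAlgebra.

Section Algebras.
Context (k : fieldType) (A : algType k).
Implicit Types (S T B I V : set A).

Definition lmul S T : set A :=
  lspan [set z | exists x y, [/\ S x, T y & z = x * y]].

Definition lpow V (m : nat) : set A := iter m (lmul V) (lspan [set 1]).

(* [k + V + V^2 + ... + V^m] *)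
Definition lgrow V (m : nat) : set A :=
  lspan (\bigcup_(j in [set j | (j <= m)%N]) lpow V j).

(* Gelfand-Kirillov dimension of a subalgebra [B] of [A]. Subspaces, their
   products and their dimensions are the same in [B] as in [A]. The first two
   terms of the sequence, where [ln m = 0], do not affect the limit superior. *)
Definition GKdim (Rr : realType) B : \bar Rr :=
  ereal_sup [set limn_esup (fun m : nat =>
               (ln ((ldim (lgrow V m))%:R : Rr) / ln (m%:R : Rr))%:E)
            | V in [set V | fin_dim V /\ V `<=` B]].

Definition two_sided_ideal I : Prop :=
  [/\ I 0, (forall x y, I x -> I y -> I (x + y)),
      (forall r x, I x -> I (r * x)) & (forall r x, I x -> I (x * r))].

Definition normal_element (a : A) : Prop :=
  [set a * r | r in setT] = [set r * a | r in setT].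

Definition non_zero_divisor (a : A) : Prop := GRing.lreg a /\ GRing.rreg a.

Definition commutative_domain : Prop :=
  (forall x y : A, x * y = y * x) /\
  (forall x y : A, x * y = 0 -> x = 0 \/ y = 0).

Record algAut := AlgAut {
  aut_fun :> {lrmorphism A -> A};
  aut_inv : A -> A;
  aut_funK : cancel aut_fun aut_inv;
  aut_invK : cancel aut_inv aut_fun }.

Definition autz (s : algAut) (z : int) : A -> A :=
  match z with
  | Posz m => iter m s
  | Negz m => iter m.+1 (aut_inv s)
  end.

Definition locally_algebraic (s : algAut) : Prop :=
  forall r : A, exists V, fin_dim V /\ forall m : nat, V (autz s m r).

End Algebras.

Arguments commutative_domain {k} A.

Section AutTheory.
Context (k : fieldType) (A : algType k).
Implicit Types (s u : algAut A) (x y : A) (a b : int).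

Lemma aut_inv_eq s x y : s x = y -> aut_inv s y = x.
Proof. by move=> <-; rewrite aut_funK. Qed.

Lemma autz1D s a x : autz s (1 + a) x = s (autz s a x).
Proof.
case: a => [m|[|m]]; [by []|by rewrite /= aut_invK|].
have -> : 1 + Negz m.+1 = Negz m by rewrite !NegzE; lia.
by rewrite /= aut_invK.
Qed.

Lemma autzN1D s a x : autz s (-1 + a) x = aut_inv s (autz s a x).
Proof. by apply/esym/aut_inv_eq; rewrite -autz1D; congr autz; lia. Qed.

Lemma autzD s a b x : autz s (a + b) x = autz s a (autz s b x).
Proof.
elim: a b x => [|m IH|m IH] b x; first by rewrite add0r.
  by rewrite intS -!addrA !autz1D IH.
by rewrite intS opprD -!addrA !autzN1D IH.
Qed.

Lemma autzP s a : exists f : {lrmorphism A -> A}, autz s a =1 f.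
Proof.
have linV : linear (aut_inv s).
  by move=> c x y; apply: aut_inv_eq; rewrite linearP /= !aut_invK.
have mulV : monoid_morphism (aut_inv s).
  split; first by apply: aut_inv_eq; rewrite rmorph1.
  by move=> x y; apply: aut_inv_eq; rewrite rmorphM /= !aut_invK.
have iterP (f : A -> A) m : linear f -> monoid_morphism f ->
    linear (iter m f) /\ monoid_morphism (iter m f).
  move=> lf [f1 fM]; split; last split.
  - by elim: m => //= m IH c x y; rewrite /= IH lf.
  - by elim: m => //= m ->.
  - by elim: m => //= m IH x y; rewrite /= IH fM.
have [la ma] : linear (autz s a) /\ monoid_morphism (autz s a).
  case: a => m; apply: iterP => //.
    by move=> c x y; rewrite linearP.
  by split; [exact: rmorph1|exact: rmorphM].
pose fl := GRing.isLinear.Build k A A *:%R (autz s a) la.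
pose fm := GRing.isMonoidMorphism.Build A A (autz s a) ma.
pose F : {lrmorphism A -> A} := HB.pack (autz s a) fl fm.
by exists F.
Qed.

Lemma aut_comm_inv s u : (forall x, s (u x) = u (s x)) ->
  forall x, s (aut_inv u x) = aut_inv u (s x).
Proof. by move=> su x; apply/esym/aut_inv_eq; rewrite -su aut_invK. Qed.

Lemma autz_comm s u a b : (forall x, s (u x) = u (s x)) ->
  forall x, autz s a (autz u b x) = autz u b (autz s a x).
Proof.
move=> su.
have iterC (f g : A -> A) m : (forall x, f (g x) = g (f x)) ->
    forall x, f (iter m g x) = iter m g (f x).
  by move=> fg x; elim: m => //= m <-; rewrite fg.
have sub x : s (autz u b x) = autz u b (s x).
  by case: b => m; apply: iterC => //; exact: aut_comm_inv.
case: a => m x; apply/esym; apply: iterC => {}x; rewrite ?sub //.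
by apply/esym/aut_inv_eq; rewrite sub aut_invK.
Qed.

End AutTheory.

(* The data defining [R_p[t^{+-1}; sigma]]. *)
Record skew_data (k : fieldType) (R : algType k) (n : nat) := SkewData {
  sigma : 'I_n -> algAut R;
  pmat : 'M[k]_n;
  sigma_comm : forall i j x, sigma i (sigma j x) = sigma j (sigma i x);
  pmat_neq0 : forall i j, pmat i j != 0;
  pmat_antisym : forall i j, pmat i j = (pmat j i)^-1 }.

(* The iterated skew Laurent extension: finitely supported families
   [(f_a)], [a \in Z^n], standing for [\sum_a f_a t_1^{a_1} ... t_n^{a_n}].
   Moving [t^a] past [s] and reordering [t^a t^b] gives
   [(r t^a)(s t^b) = c(a, b) r sigma^a(s) t^{a+b}], where
   [c(a, b) = \prod_{i < j} p_{ij}^{a_j b_i}] comes from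
   [t_j t_i = p_{ij} t_i t_j]. *)
Record skewLaurent (k : fieldType) (R : algType k) (n : nat)
  (D : skew_data R n) : predArgType :=
  SkewLaurent { sl_val : {fsfun {ffun 'I_n -> int} -> R with 0} }.

Section SkewLaurent.
Context (k : fieldType) (R : algType k) (n : nat) (D : skew_data R n).

Local Notation Zn := {ffun 'I_n -> int}.
Local Notation L := (skewLaurent D).
Implicit Types (f g h : L) (a b d : Zn) (r s : R).

HB.instance Definition _ := [isNew for @sl_val k R n D].
HB.instance Definition _ := [Choice of L by <:].

Definition coef f a : R := sl_val f a.
Definition supp f : {fset Zn} := finsupp (sl_val f).

Definition sigmaz a : R -> R := \big[comp/id]_(i < n) autz (sigma D i) (a i).

Definition cocycle a b : k :=
  \prod_(i < n) \prod_(j < n | (i < j)%N) pmat D i j ^ (a j * b i).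

Lemma slP f g : (forall a, coef f a = coef g a) <-> f = g.
Proof.
by case: f g => [f] [g]; split=> [h|->//]; congr SkewLaurent; apply/fsfunP/h.
Qed.

Definition sl_make (E : {fset Zn}) (F : Zn -> R) : L :=
  SkewLaurent D [fsfun a in E => F a].

Lemma coef_make E F a : coef (sl_make E F) a = if a \in E then F a else 0.
Proof. exact: fsfun_fun. Qed.

Lemma coef_out f a : a \notin supp f -> coef f a = 0.
Proof. exact: fsfun_dflt. Qed.

Lemma mem_supp f a : (a \in supp f) = (coef f a != 0).
Proof. by rewrite /supp mem_finsupp. Qed.

Definition sl_zero : L := sl_make fset0 (fun=> 0).
Definition sl_opp f : L := sl_make (supp f) (fun a => - coef f a).
Definition sl_add f g : L :=
  sl_make (supp f `|` supp g)%fset (fun a => coef f a + coef g a).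

Lemma coef_zero a : coef sl_zero a = 0.
Proof. by rewrite coef_make. Qed.

Lemma coef_opp f a : coef (sl_opp f) a = - coef f a.
Proof.
by rewrite coef_make; case: ifPn => // /coef_out ->; rewrite oppr0.
Qed.

Lemma coef_add f g a : coef (sl_add f g) a = coef f a + coef g a.
Proof.
rewrite coef_make in_fsetU; case: ifPn => //.
by rewrite negb_or => /andP[/coef_out -> /coef_out ->]; rewrite addr0.
Qed.

Fact sl_addA : associative sl_add.
Proof. by move=> f g h; apply/slP=> a; rewrite !coef_add addrA. Qed.
Fact sl_addC : commutative sl_add.
Proof. by move=> f g; apply/slP=> a; rewrite !coef_add addrC. Qed.
Fact sl_add0 : left_id sl_zero sl_add.
Proof. by move=> f; apply/slP=> a; rewrite coef_add coef_zero add0r. Qed.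
Fact sl_addN : left_inverse sl_zero sl_opp sl_add.
Proof.
by move=> f; apply/slP=> a; rewrite coef_add coef_opp coef_zero addNr.
Qed.

HB.instance Definition _ := GRing.isZmodule.Build L
  sl_addA sl_addC sl_add0 sl_addN.

Definition sl_scale (c : k) f : L := sl_make (supp f) (fun a => c *: coef f a).

Lemma coef_scale c f a : coef (sl_scale c f) a = c *: coef f a.
Proof.
by rewrite coef_make; case: ifPn => // /coef_out ->; rewrite scaler0.
Qed.

Fact sl_scaleA c c' f : sl_scale c (sl_scale c' f) = sl_scale (c * c') f.
Proof. by apply/slP=> a; rewrite !coef_scale scalerA. Qed.
Fact sl_scale1 : left_id 1 sl_scale.
Proof. by move=> f; apply/slP=> a; rewrite coef_scale scale1r. Qed.
Fact sl_scaleDr : right_distributive sl_scale +%R.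
Proof.
by move=> c f g; apply/slP=> a; rewrite !(coef_scale, coef_add) scalerDr.
Qed.
Fact sl_scaleDl f : {morph sl_scale^~ f : c c' / c + c'}.
Proof.
by move=> c c'; apply/slP=> a; rewrite !(coef_scale, coef_add) scalerDl.
Qed.

HB.instance Definition _ := GRing.Zmodule_isLmodule.Build k L
  sl_scaleA sl_scale1 sl_scaleDr sl_scaleDl.

Lemma coefD f g a : coef (f + g) a = coef f a + coef g a.
Proof. exact: coef_add. Qed.
Lemma coefZ c f a : coef (c *: f) a = c *: coef f a.
Proof. exact: coef_scale. Qed.
Lemma coef0 a : coef 0 a = 0.
Proof. exact: coef_zero. Qed.
Lemma coef_sum T (t : seq T) (P : pred T) (F : T -> L) a :
  coef (\sum_(i <- t | P i) F i) a = \sum_(i <- t | P i) coef (F i) a.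
Proof. by apply: (big_morph (coef^~ a)) => [f g|]; rewrite ?coefD ?coef0. Qed.

(* [r t^a] *)
Definition mono a r : L := sl_make [fset a]%fset (fun=> r).

Lemma coef_mono a r b : coef (mono a r) b = if b == a then r else 0.
Proof. by rewrite coef_make in_fset1. Qed.

Lemma monoD a r s : mono a (r + s) = mono a r + mono a s.
Proof.
by apply/slP=> b; rewrite coefD !coef_mono; case: eqP; rewrite ?addr0.
Qed.

Lemma mono0 a : mono a 0 = 0.
Proof. by apply/slP=> b; rewrite coef0 coef_mono if_same. Qed.

Lemma monoZ a c r : mono a (c *: r) = c *: mono a r.
Proof.
by apply/slP=> b; rewrite coefZ !coef_mono; case: eqP; rewrite ?scaler0.
Qed.

Lemma supp_mono a r : (supp (mono a r) `<=` [fset a])%fset.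
Proof.
apply/fsubsetP => b; rewrite mem_supp coef_mono in_fset1.
by case: (b == a) => //; rewrite eqxx.
Qed.

Lemma sl_expand_in (E : {fset Zn}) f : (supp f `<=` E)%fset ->
  f = \sum_(a <- E) mono a (coef f a).
Proof.
move=> /fsubsetP fE; apply/slP=> b; rewrite coef_sum.
have [bE|bE] := boolP (b \in E).
  rewrite (big_fsetD1 b) //= coef_mono eqxx big1_fset ?addr0 // => a.
  by rewrite in_fsetD1 coef_mono (eq_sym b); case: (a == b).
rewrite big1_fset => [|a aE _]; first by rewrite coef_out ?(contra (@fE b)).
by rewrite coef_mono; case: eqP bE => // ->; rewrite aE.
Qed.

Lemma sl_expand f : f = \sum_(a <- supp f) mono a (coef f a).
Proof. exact/sl_expand_in. Qed.

Lemma big_compD (I : Type) (t : seq I) (F G : I -> R -> R) :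
  (forall i j x, F i (G j x) = G j (F i x)) ->
  \big[comp/id]_(i <- t) (F i \o G i) =1
  (\big[comp/id]_(i <- t) F i) \o (\big[comp/id]_(i <- t) G i).
Proof.
move=> FG; elim: t => [|i t IH] x; rewrite ?big_nil ?big_cons //=.
rewrite IH /=; congr (F i _).
elim: t ((\big[comp/id]_(j <- t) G j) x) {IH} => [|j t IH] y.
  by rewrite !big_nil.
by rewrite !big_cons /= -FG IH.
Qed.

Lemma sigmaz0 : sigmaz 0 =1 id.
Proof.
move=> x; rewrite /sigmaz; elim: (index_enum _) => [|i t IH].
  by rewrite big_nil.
by rewrite big_cons /= IH ffunE.
Qed.

Lemma sigmazD a b x : sigmaz (a + b) x = sigmaz a (sigmaz b x).
Proof.
rewrite -[RHS]big_compD; last first.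
  by move=> i j y; apply: autz_comm => z; exact: sigma_comm.
rewrite /sigmaz; congr (_ x); apply: eq_bigr => i _.
by apply/funext => y; rewrite /= ffunE autzD.
Qed.

Lemma sigmazP a : exists F : {lrmorphism R -> R}, sigmaz a =1 F.
Proof.
rewrite /sigmaz; elim: (index_enum _) => [|i t [F FE]].
  by exists (@idfun R : {lrmorphism R -> R}) => x; rewrite big_nil.
have [G GE] := autzP (sigma D i) (a i).
by exists (G \o F : {lrmorphism R -> R}) => x; rewrite big_cons /= FE GE.
Qed.

Lemma sigmaz_add a x y : sigmaz a (x + y) = sigmaz a x + sigmaz a y.
Proof. by have [F FE] := sigmazP a; rewrite !FE rmorphD. Qed.
Lemma sigmaz_zero a : sigmaz a 0 = 0.
Proof. by have [F FE] := sigmazP a; rewrite !FE rmorph0. Qed.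
Lemma sigmaz_one a : sigmaz a 1 = 1.
Proof. by have [F FE] := sigmazP a; rewrite !FE rmorph1. Qed.
Lemma sigmaz_mul a x y : sigmaz a (x * y) = sigmaz a x * sigmaz a y.
Proof. by have [F FE] := sigmazP a; rewrite !FE rmorphM. Qed.
Lemma sigmaz_scale a c x : sigmaz a (c *: x) = c *: sigmaz a x.
Proof. by have [F FE] := sigmazP a; rewrite !FE linearZ. Qed.

Lemma cocycleDl a b d : cocycle (a + b) d = cocycle a d * cocycle b d.
Proof.
rewrite /cocycle -big_split; apply: eq_bigr => i _.
rewrite -big_split; apply: eq_bigr => j _ /=.
by rewrite ffunE mulrDl expfzDr ?pmat_neq0.
Qed.

Lemma cocycleDr a b d : cocycle d (a + b) = cocycle d a * cocycle d b.
Proof.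
rewrite /cocycle -big_split; apply: eq_bigr => i _.
rewrite -big_split; apply: eq_bigr => j _ /=.
by rewrite ffunE mulrDr expfzDr ?pmat_neq0.
Qed.

Lemma cocycle0l a : cocycle 0 a = 1.
Proof.
by apply: big1 => i _; apply: big1 => j _; rewrite ffunE mul0r expr0z.
Qed.

Lemma cocycle0r a : cocycle a 0 = 1.
Proof.
by apply: big1 => i _; apply: big1 => j _; rewrite ffunE mulr0 expr0z.
Qed.

Local Notation mulmono f g a b :=
  (mono (a + b) (cocycle a b *: (coef f a * sigmaz a (coef g b)))).

Definition sl_mul f g : L :=
  \sum_(a <- supp f) \sum_(b <- supp g) mulmono f g a b.

Definition sl_one : L := mono 0 1.

Lemma sl_mul_in (E1 E2 : {fset Zn}) f g :
  (supp f `<=` E1)%fset -> (supp g `<=` E2)%fset ->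
  sl_mul f g = \sum_(a <- E1) \sum_(b <- E2) mulmono f g a b.
Proof.
move=> le1 le2; rewrite /sl_mul (big_fset_incl _ le1) /=.
  apply/eq_bigr=> a _; apply/big_fset_incl => // b _ /coef_out ->.
  by rewrite sigmaz_zero mulr0 scaler0 mono0.
move=> a _ /coef_out fa; rewrite big1 // => b _.
by rewrite fa mul0r scaler0 mono0.
Qed.

Lemma sl_mul_mono a b r s :
  sl_mul (mono a r) (mono b s) =
  mono (a + b) (cocycle a b *: (r * sigmaz a s)).
Proof.
rewrite (sl_mul_in (supp_mono a r) (supp_mono b s)) !big_seq_fset1.
by rewrite !coef_mono !eqxx.
Qed.

Fact sl_mulDl : left_distributive sl_mul +%R.
Proof.
move=> f g h; pose E := (supp f `|` supp g)%fset.
have leE : (supp (f + g)%R `<=` E)%fset.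
  apply/fsubsetP => a; rewrite in_fsetU; apply: contraLR.
  rewrite negb_or => /andP[/coef_out fa /coef_out ga].
  by rewrite mem_supp coefD fa ga addr0 eqxx.
rewrite (sl_mul_in leE (fsubset_refl _)).
rewrite (sl_mul_in (fsubsetUl (supp f) (supp g)) (fsubset_refl _)).
rewrite (sl_mul_in (fsubsetUr (supp f) (supp g)) (fsubset_refl _)).
rewrite -big_split /=; apply/eq_bigr=> a _.
rewrite -big_split /=; apply/eq_bigr=> b _.
by rewrite coefD mulrDl scalerDr monoD.
Qed.

Fact sl_mulDr : right_distributive sl_mul +%R.
Proof.
move=> h f g; pose E := (supp f `|` supp g)%fset.
have leE : (supp (f + g)%R `<=` E)%fset.
  apply/fsubsetP => a; rewrite in_fsetU; apply: contraLR.
  rewrite negb_or => /andP[/coef_out fa /coef_out ga].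
  by rewrite mem_supp coefD fa ga addr0 eqxx.
rewrite (sl_mul_in (fsubset_refl _) leE).
rewrite (sl_mul_in (fsubset_refl _) (fsubsetUl (supp f) (supp g))).
rewrite (sl_mul_in (fsubset_refl _) (fsubsetUr (supp f) (supp g))).
rewrite -big_split /=; apply/eq_bigr=> a _.
rewrite -big_split /=; apply/eq_bigr=> b _.
by rewrite coefD sigmaz_add mulrDr scalerDr monoD.
Qed.

Lemma supp0 : supp 0 = fset0.
Proof. by apply/fsetP => a; rewrite mem_supp coef0 eqxx in_fset0. Qed.

Fact sl_mul0l : left_zero 0 sl_mul.
Proof. by move=> f; rewrite /sl_mul supp0 big_seq_fset0. Qed.

Fact sl_mul0r : right_zero 0 sl_mul.
Proof.
by move=> f; rewrite /sl_mul big1 // => a _; rewrite supp0 big_seq_fset0.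
Qed.

Lemma sl_mul_suml T (t : seq T) (F : T -> L) g :
  sl_mul (\sum_(i <- t) F i) g = \sum_(i <- t) sl_mul (F i) g.
Proof.
by apply: (big_morph (sl_mul^~ g)) => [f h|]; [exact: sl_mulDl|exact: sl_mul0l].
Qed.

Lemma sl_mul_sumr T (t : seq T) (F : T -> L) g :
  sl_mul g (\sum_(i <- t) F i) = \sum_(i <- t) sl_mul g (F i).
Proof.
by apply: (big_morph (sl_mul g)) => [f h|]; [exact: sl_mulDr|exact: sl_mul0r].
Qed.

Fact sl_mulA : associative sl_mul.
Proof.
move=> f g h; rewrite (sl_expand f) (sl_expand g) (sl_expand h).
rewrite !sl_mul_suml; apply: eq_bigr => a _.
rewrite sl_mul_sumr [in RHS](sl_mul_sumr (supp g)) [RHS]sl_mul_suml.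
apply: eq_bigr => b _; rewrite !sl_mul_sumr; apply: eq_bigr => d _.
rewrite !sl_mul_mono addrA; congr mono.
rewrite sigmaz_scale sigmaz_mul -scalerAr -scalerAl !scalerA mulrA sigmazD.
by congr (_ *: _); rewrite cocycleDl cocycleDr; ring.
Qed.

Fact sl_mul1l : left_id sl_one sl_mul.
Proof.
move=> f; rewrite [in LHS](sl_expand f) [RHS]sl_expand sl_mul_sumr.
apply: eq_bigr => a _.
by rewrite sl_mul_mono add0r cocycle0l scale1r mul1r sigmaz0.
Qed.

Fact sl_mul1r : right_id sl_one sl_mul.
Proof.
move=> f; rewrite [in LHS](sl_expand f) [RHS]sl_expand sl_mul_suml.
apply: eq_bigr => a _.
by rewrite sl_mul_mono addr0 cocycle0r scale1r sigmaz_one mulr1.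
Qed.

Fact sl_one_neq0 : sl_one != 0.
Proof.
apply/eqP => /slP /(_ 0); rewrite coef_mono eqxx coef0.
by apply/eqP; exact: oner_neq0.
Qed.

HB.instance Definition _ := GRing.Zmodule_isNzRing.Build L
  sl_mulA sl_mul1l sl_mul1r sl_mulDl sl_mulDr sl_one_neq0.

Lemma mulmonoE a b r s :
  mono a r * mono b s = mono (a + b) (cocycle a b *: (r * sigmaz a s)).
Proof. exact: sl_mul_mono. Qed.

Fact sl_scaleAl c f g : c *: (f * g) = (c *: f) * g.
Proof.
rewrite (sl_expand f) (sl_expand g) [in RHS]scaler_sumr !mulr_suml scaler_sumr.
apply: eq_bigr => a _; rewrite !mulr_sumr scaler_sumr; apply: eq_bigr => b _.
by rewrite -monoZ !mulmonoE -scalerAl -monoZ !scalerA mulrC.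
Qed.

Fact sl_scaleAr c f g : c *: (f * g) = f * (c *: g).
Proof.
rewrite (sl_expand f) (sl_expand g) [in RHS]scaler_sumr !mulr_suml scaler_sumr.
apply: eq_bigr => a _; rewrite !mulr_sumr scaler_sumr; apply: eq_bigr => b _.
by rewrite -monoZ !mulmonoE sigmaz_scale -scalerAr -monoZ !scalerA mulrC.
Qed.

HB.instance Definition _ := GRing.Lmodule_isLalgebra.Build k L sl_scaleAl.
HB.instance Definition _ := GRing.Lalgebra_isAlgebra.Build k L sl_scaleAr.

Definition sl_const r : L := mono 0 r.

(* [e_i z] is the vector with [z] in position [i] and [0] elsewhere. *)
Definition ebase (i : 'I_n) (z : int) : Zn :=
  [ffun j => if j == i then z else 0].

Definition tgen i : L := mono (ebase i 1) 1.
Definition tinv i : L := mono (ebase i (-1)) 1.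

Definition tpow i (z : int) : L :=
  match z with
  | Posz m => tgen i ^+ m
  | Negz m => tinv i ^+ m.+1
  end.

(* [t_1^{a_1} ... t_n^{a_n}] *)
Definition tmon a : L := \prod_(i < n) tpow i (a i).

Lemma ebaseD i z w : ebase i z + ebase i w = ebase i (z + w).
Proof. by apply/ffunP => j; rewrite !ffunE; case: eqP; rewrite ?addr0. Qed.

Lemma ebase0 i : ebase i 0 = 0.
Proof. by apply/ffunP => j; rewrite !ffunE if_same. Qed.

Lemma sigmaz_ebase i z : sigmaz (ebase i z) =1 autz (sigma D i) z.
Proof.
move=> x; rewrite /sigmaz; have := index_enum_uniq 'I_n.
have : i \in index_enum 'I_n by rewrite mem_index_enum.
have out (s : seq 'I_n) y : i \notin s ->
    (\big[comp/id]_(j <- s) autz (sigma D j) (ebase i z j)) y = y.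
  elim: s => [|j s IH]; first by rewrite big_nil.
  rewrite in_cons negb_or big_cons /= ffunE => /andP[ij /IH ->].
  by rewrite eq_sym (negbTE ij).
elim: (index_enum _) => [|j s IH]; first by [].
rewrite in_cons big_cons /= ffunE => + /andP[js us].
case: eqP => [ij _|ij /= si]; first by rewrite -ij eqxx out // ij.
by rewrite IH //; case: eqP ij => // ->.
Qed.

Lemma cocycle_eq1 a b :
  (forall i j : 'I_n, (i < j)%N -> a j != 0 -> b i = 0) -> cocycle a b = 1.
Proof.
move=> ab; apply: big1 => i _; apply: big1 => j ij.
have [->|aj] := eqVneq (a j) 0; first by rewrite mul0r expr0z.
by rewrite (ab i j) // mulr0 expr0z.
Qed.

Lemma cocycle_ebase i z w : cocycle (ebase i z) (ebase i w) = 1.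
Proof.
apply: cocycle_eq1 => j l ij; rewrite !ffunE.
have [li|_] := eqVneq l i; last by rewrite eqxx.
by have [ji|] := eqVneq j i; first by rewrite li ji ltnn in ij.
Qed.

Lemma mono_ebaseD i z w :
  mono (ebase i z) 1 * mono (ebase i w) 1 = mono (ebase i (z + w)) 1 :> L.
Proof.
by rewrite mulmonoE cocycle_ebase scale1r sigmaz_one mulr1 ebaseD.
Qed.

Lemma tgenK i : tgen i * tinv i = 1.
Proof. by rewrite mono_ebaseD subrr ebase0. Qed.

Lemma tinvK i : tinv i * tgen i = 1.
Proof. by rewrite mono_ebaseD addNr ebase0. Qed.

Lemma tgen_const i r : tgen i * sl_const r = sl_const (sigma D i r) * tgen i.
Proof.
rewrite !mulmonoE cocycle0l cocycle0r !scale1r addr0 add0r mul1r.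
by rewrite sigmaz0 mulr1 sigmaz_ebase.
Qed.

Lemma tinv_const i r :
  tinv i * sl_const r = sl_const (aut_inv (sigma D i) r) * tinv i.
Proof.
rewrite !mulmonoE cocycle0l cocycle0r !scale1r addr0 add0r mul1r.
by rewrite sigmaz0 mulr1 sigmaz_ebase.
Qed.

Lemma tgen_comm i j : i != j ->
  tgen j * tgen i = pmat D i j *: (tgen i * tgen j).
Proof.
have cE u v : cocycle (ebase u 1) (ebase v 1) =
    if (v < u)%N then pmat D v u else 1.
  rewrite /cocycle (bigD1 v) //= [X in _ * X]big1 ?mulr1; last first.
    move=> l /negbTE lv; apply: big1 => m _.
    by rewrite [ebase v 1 l]ffunE lv mulr0 expr0z.
  case: ifPn => uv; last first.
    apply: big1 => m vm; rewrite [ebase u 1 m]ffunE.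
    case: eqP vm uv => [-> ->//|_ _ _]; by rewrite mul0r expr0z.
  rewrite (bigD1 u) //= [X in _ * X]big1 ?mulr1; last first.
    by move=> l /andP[_ /negbTE lu]; rewrite [ebase u 1 l]ffunE lu mul0r expr0z.
  by rewrite !ffunE !eqxx mulr1 expr1z.
move=> ij; rewrite !mulmonoE !sigmaz_one !mulr1 -monoZ scalerA addrC !cE.
congr (mono _ (_ *: _)).
case: ltngtP => [lt|lt|/val_inj eq]; last by rewrite eq eqxx in ij.
- by rewrite mulr1.
- by rewrite pmat_antisym mulVf ?pmat_neq0.
Qed.

Lemma sl_constD r s : sl_const (r + s) = sl_const r + sl_const s.
Proof. exact: monoD. Qed.

Lemma sl_constZ c r : sl_const (c *: r) = c *: sl_const r.
Proof. exact: monoZ. Qed.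

Lemma sl_constM r s : sl_const (r * s) = sl_const r * sl_const s.
Proof. by rewrite mulmonoE addr0 cocycle0l scale1r sigmaz0. Qed.

Lemma sl_const1 : sl_const 1 = 1.
Proof. by []. Qed.

Lemma tpowE i z : tpow i z = mono (ebase i z) 1.
Proof.
have powE e m : mono (ebase i e) 1 ^+ m = mono (ebase i (e *+ m)) 1 :> L.
  elim: m => [|m IH]; first by rewrite expr0 mulr0n ebase0.
  by rewrite exprS IH mono_ebaseD mulrS.
case: z => m; rewrite /= powE; congr (mono (ebase _ _) _).
  by rewrite natz.
by rewrite NegzE mulNrn natz.
Qed.

Lemma tmonE a : tmon a = mono a 1.
Proof.
rewrite /tmon /index_enum locked_withE -enumT.
pose re (s : seq 'I_n) : Zn := [ffun j => if j \in s then a j else 0].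
suff prodE (s : seq 'I_n) : sorted ltn (map val s) ->
    \prod_(i <- s) tpow i (a i) = mono (re s) 1 :> L.
  rewrite prodE; last by rewrite val_enum_ord iota_ltn_sorted.
  by congr mono; apply/ffunP => j; rewrite ffunE mem_enum.
elim: s => [_|i s IH /= ps].
  rewrite big_nil; congr mono; apply/ffunP => j; by rewrite !ffunE.
rewrite big_cons IH ?(path_sorted ps) // tpowE mulmonoE sigmaz_one mulr1.
have is_ j : j \in s -> (i < j)%N.
  move=> js; have := order_path_min ltn_trans ps.
  by move=> /allP /(_ (val j)); apply; apply: map_f.
rewrite cocycle_eq1 ?scale1r.
  congr mono; apply/ffunP => j; rewrite !ffunE in_cons.
  case: eqP => [->|_] /=; last by rewrite add0r.
  by case: ifPn => [/is_|]; rewrite ?ltnn ?addr0.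
move=> j l jl; rewrite !ffunE; have [li _|] := eqVneq l i; last by rewrite eqxx.
by case: ifPn => // /is_; rewrite -li ltnNge ltnW.
Qed.

Lemma monoE a r : mono a r = sl_const r * tmon a.
Proof.
by rewrite tmonE mulmonoE cocycle0l scale1r add0r sigmaz0 mulr1.
Qed.

(* The ordered monomials form a basis of the left [R]-module. *)
Lemma sl_expand_tmon f : f = \sum_(a <- supp f) sl_const (coef f a) * tmon a.
Proof. by rewrite {1}(sl_expand f); apply: eq_bigr => a _; rewrite monoE. Qed.

Lemma coef_tmon r a b : coef (sl_const r * tmon a) b = if b == a then r else 0.
Proof. by rewrite -monoE coef_mono. Qed.

End SkewLaurent.

Section BRAlgebra.
Context (k : fieldType) (R : algType k) (n : nat) (D : skew_data R n).
Context (H J : 'I_n -> set R).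

(* [I_i^{(z)}]; the unit ideal [setT = R] is neutral for products of ideals. *)
Definition BRfactor (i : 'I_n) (z : int) : set R :=
  match z with
  | Posz m => \big[@lmul k R/setT]_(j < m) (autz (sigma D i) (j : nat) @` J i)
  | Negz m =>
      \big[@lmul k R/setT]_(j < m.+1) (autz (sigma D i) (- j.+1%:Z) @` H i)
  end.

Definition BRcoef (a : {ffun 'I_n -> int}) : set R :=
  \big[@lmul k R/setT]_(i < n) BRfactor i (a i).

Record BR_axioms : Prop := {
  BR_idealH : forall i, two_sided_ideal (H i);
  BR_idealJ : forall i, two_sided_ideal (J i);
  BR_sigmaH : forall i j, i != j -> sigma D i @` H j = H j;
  BR_sigmaJ : forall i j, i != j -> sigma D i @` J j = J j;
  BR_HH : forall i j, i != j -> lmul (H i) (H j) = lmul (H j) (H i);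
  BR_HJ : forall i j, i != j -> lmul (H i) (J j) = lmul (J j) (H i);
  BR_JJ : forall i j, i != j -> lmul (J i) (J j) = lmul (J j) (J i);
  BR_neq0 : forall i z, BRfactor i z <> [set 0] }.

(* [\bigoplus_a I_1^{(a_1)} ... I_n^{(a_n)} t_1^{a_1} ... t_n^{a_n}] *)
Definition BR : set (skewLaurent D) :=
  lspan [set f | exists a r, BRcoef a r /\ f = sl_const D r * tmon D a].

Lemma BRcoef_lin a (c : k) x y :
  BRcoef a x -> BRcoef a y -> BRcoef a (c *: x + y).
Proof.
rewrite /BRcoef; elim: (index_enum _) => [|i s _]; first by rewrite big_nil.
by rewrite big_cons; apply: lspan_lin.
Qed.

Lemma BRcoef0 a : BRcoef a 0.
Proof.
rewrite /BRcoef; elim: (index_enum _) => [|i s _]; first by rewrite big_nil.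
by rewrite big_cons; apply: lspan0.
Qed.

Lemma BRP f : BR f <-> forall a, BRcoef a (coef f a).
Proof.
split=> [[m [c [w [Sw ->]]]] a|fI].
  rewrite coef_sum; elim/big_ind: _ => [|x y Ix Iy|i _]; first exact: BRcoef0.
    by rewrite -[x]scale1r; apply: BRcoef_lin.
  have [b [r [Ir ->]]] := Sw i; rewrite coefZ coef_tmon.
  case: eqP => [->|_]; last by rewrite scaler0; exact: BRcoef0.
  by rewrite -[_ *: _]addr0; apply: BRcoef_lin => //; exact: BRcoef0.
rewrite (sl_expand_tmon f); elim/big_ind: _ => [|x y Bx By|a _].
- exact: lspan0.
- by rewrite -[x]scale1r; apply: lspan_lin.
- by apply: lspan_gen; exists a, (coef f a).
Qed.

End BRAlgebra.

Arguments BRfactor {k R n} D H J i z.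
Arguments BRcoef {k R n} D H J a.
Arguments BR_axioms {k R n} D H J.
Arguments BR {k R n} D H J.

(* Main.v *)
Require Import Defs.
From HB Require Import structures.
From mathcomp Require Import all_boot all_order all_algebra.
From mathcomp Require Import finmap.
From mathcomp Require Import all_classical all_reals all_analysis.
From mathcomp Require Import lra zify.

Set Implicit Arguments.
Unset Strict Implicit.
Unset Printing Implicit Defensive.

Import Order.TTheory GRing.Theory Num.Theory.

Local Open Scope classical_set_scope.
Local Open Scope ring_scope.

(** Write [B] for the BR algebra, a subalgebra of the skew Laurent ring [L] over
    [R], and measure growth by [ldim (lgrow V m)]. The theorem compares the
    growth of finite-dimensional subspaces of [B] with the growth of
    finite-dimensional subspaces of [R].

    Upper bound. Only finitely many elements of [R] occur as coefficients in a
    finite-dimensional subspace [V] of [L]. As the [sigma_i] commute and are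
    locally algebraic, these coefficients lie in a finite-dimensional space [W]
    which contains [1] and is stable under every [sigma_i] ([stable_hull]). A
    stable finite-dimensional space is also stable under the inverses
    ([stable_inv]), so moving a monomial [t^a] past a coefficient keeps the
    coefficient in [W]. Hence a product of [m] elements of [V] has its
    coefficients in [W^m] and its degrees in a cube of side [O(m)], and
    [ldim (lgrow V m) <= (C m)^n ldim (lgrow W m)] ([upper_growth]). This
    concerns all of [L], of which [B] is a subspace.

    Lower bounds. The degree-zero part of [B] is [R], which gives
    [GKdim R <= GKdim B]. Suppose that, for one sign, [B] contains for every
    [i] a monomial [x_i = r_i t_i^(+-1)] with [r_i] right regular. The products
    [x_1^(e_1) ... x_n^(e_n)] with [e_i < m] are [m^n] monomials of distinct
    degrees, and their coefficients are right regular because automorphisms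
    preserve right regularity. Hence the left multiples of these monomials by
    [lgrow W m] form a direct sum of [m^n] copies of [lgrow W m]
    ([card_monomials_le]). If [V] contains [W], [1] and the [x_i], all of this
    happens inside [lgrow V ((n + 1) m)], so [GKdim B >= GKdim R + n]. A regular
    element [a] of [J_i] provides [x_i = a t_i], and a regular element [b] of
    [H_i] provides [x_i = sigma_i^(-1)(b) t_i^(-1)]. In a commutative domain any
    nonzero element of [J_i] will do, and there is one because
    [I_i^(1) = J_i] is nonzero.

    Passing from these inequalities to the limit superior of
    [ln (ldim (lgrow V m)) / ln m] is [growth_rate_upper] and
    [growth_rate_lower]: constant factors and a linear change of [m]
    contribute [O(1 / ln m)], while a factor [m^n] contributes [n]. *)

(** * Finite-dimensional subspaces *)

Section Subspaces.
Context (k : fieldType) (V : lmodType k).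
Implicit Types (S T W : set V) (v w : V) (s : seq V).

Definition lin_subspace W : Prop := lspan W `<=` W.

Lemma lspan_sum S (I : Type) (r : seq I) (P : pred I) (F : I -> V) :
  (forall i, P i -> lspan S (F i)) -> lspan S (\sum_(i <- r | P i) F i).
Proof.
move=> SF; apply: (big_ind (lspan S)) => //; first exact: lspan0.
by move=> v w Sv Sw; rewrite -[v]scale1r; exact: lspan_lin.
Qed.

Lemma lspanZ S c v : lspan S v -> lspan S (c *: v).
Proof.
by move=> Sv; rewrite -[_ *: _]addr0; apply: lspan_lin => //; exact: lspan0.
Qed.

Lemma subspace_lspan S : lin_subspace (lspan S).
Proof.
move=> v [m [c [w [Sw ->]]]].
by apply: lspan_sum => i _; exact/lspanZ.
Qed.

Lemma subspaceP W : W 0 -> (forall c v w, W v -> W w -> W (c *: v + w)) ->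
  lin_subspace W.
Proof.
move=> W0 WD v [m [c [w [Ww ->]]]].
by elim/big_ind: _ => // [x y Wx Wy|i _];
  [rewrite -[x]scale1r; exact: WD|rewrite -[_ *: _]addr0; exact: WD].
Qed.

Lemma lspan_min S W : lin_subspace W -> S `<=` W -> lspan S `<=` W.
Proof.
move=> sW SW v [m [c [w [Sw ->]]]]; apply: sW.
by exists m, c, w; split => // i; exact: SW.
Qed.

Lemma lspan_mono S T : S `<=` T -> lspan S `<=` lspan T.
Proof.
move=> ST; apply: lspan_min (subspace_lspan (S := T)) _ => v /ST.
exact: lspan_gen.
Qed.

Lemma subspace_sum W (I : Type) (r : seq I) (P : pred I) (F : I -> V) :
  lin_subspace W -> (forall i, P i -> W (F i)) -> W (\sum_(i <- r | P i) F i).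
Proof. by move=> sW WF; apply/sW/lspan_sum => i /WF; exact: lspan_gen. Qed.

(** Vectors in the span of a finite family are combinations of that very
    family; this absorbs the repetitions which the definition of a span
    allows. *)
Lemma lspan_rangeP (I : finType) (f : I -> V) v :
  lspan (range f) v <-> exists c : I -> k, v = \sum_i c i *: f i.
Proof.
split=> [[m [c [w [fw ->]]]]|[c ->]]; last first.
  by apply: lspan_sum => i _; apply/lspanZ/lspan_gen; exists i.
have /choice [h hE] i : exists j, f j = w i by have [j _ <-] := fw i; exists j.
exists (fun j => \sum_(i < m | h i == j) c i).
rewrite (partition_big h xpredT) //=; apply: eq_bigr => j _.
rewrite scaler_suml; apply: eq_bigr => i /eqP ij.
by rewrite -(hE i) ij.
Qed.

Lemma range_enum_val (I : finType) (f : I -> V) :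
  range (f \o enum_val : 'I_#|I| -> V) = range f.
Proof.
apply/seteqP; split=> v [i _ <-]; first by exists (enum_val i).
by exists (enum_rank i) => //=; rewrite enum_rankK.
Qed.

(** [lin_indep] for families indexed by any finite type: the families built below
    are indexed by pairs of an exponent and a basis index. *)
Definition indep (I : finType) (e : I -> V) : Prop :=
  forall c : I -> k, \sum_i c i *: e i = 0 -> forall i, c i = 0.

Lemma indep_enum (I : finType) (e : I -> V) : indep e ->
  lin_indep (e \o enum_val : 'I_#|I| -> V).
Proof.
move=> ie c ce i; pose d j := c (enum_rank j).
rewrite -[i]enum_valK; apply: (ie d).
rewrite -[RHS]ce [RHS](reindex enum_rank) /=; last first.
  by apply: onW_bij; exact: enum_rank_bij.
by apply: eq_bigr => j _; rewrite enum_rankK.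
Qed.

(** A matrix with more rows than columns has a nonzero vector in its left
    kernel, which gives a relation between the members of [e]. *)
Lemma steinitz d m (e : 'I_d -> V) (f : 'I_m -> V) :
  lin_indep e -> (forall i, lspan (range f) (e i)) -> (d <= m)%N.
Proof.
move=> ie fe; have /choice [c cE] i := (lspan_rangeP f (e i)).1 (fe i).
pose A : 'M[k]_(d, m) := \matrix_(i, j) c i j.
suff /eqP <- : row_free A by exact: rank_leq_col.
rewrite -kermx_eq0; apply/eqP/row_matrixP => i; rewrite row0.
have : row i (kermx A) *m A = 0 by apply: sub_kermxP; exact: row_sub.
move: (row i _) => u uA; apply/rowP => j; rewrite mxE.
apply: (ie (u 0)); under eq_bigr do rewrite cE scaler_sumr.
rewrite exchange_big big1 //= => l _.
under eq_bigr do rewrite scalerA.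
rewrite -scaler_suml; have /rowP/(_ l) := uA; rewrite !mxE.
under eq_bigr do rewrite mxE.
by move=> ->; exact: scale0r.
Qed.

Lemma ldimP W : fin_dim W -> has_dim W (ldim W).
Proof. by move=> [d Wd]; exact: (xgetI _ Wd). Qed.

Lemma ldim_basis W : fin_dim W -> exists e : 'I_(ldim W) -> V,
  [/\ indep e, forall i, W (e i) &
      forall v, W v -> exists c : 'I_(ldim W) -> k, v = \sum_i c i *: e i].
Proof.
move=> /ldimP [e [ie We]]; exists e; split => // [i|v Wv].
  by rewrite We; apply: lspan_gen; exists i.
by apply/lspan_rangeP; rewrite -We.
Qed.

Lemma fin_dim_subspace W : fin_dim W -> lin_subspace W.
Proof. by move=> [d [e [_ ->]]]; exact: subspace_lspan. Qed.

(** Steinitz exchange when [W] is finite-dimensional; otherwise [ldim W] is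
    [0]. *)
Lemma ldim_le_card W (I : finType) (f : I -> V) :
  W `<=` lspan (range f) -> (ldim W <= #|I|)%N.
Proof.
move=> Wf; have [/ldimP [e [ie We]]|nW] := pselect (fin_dim W); last first.
  by rewrite /ldim xgetPN // => d dW; apply: nW; exists d.
apply: (steinitz ie (f := f \o enum_val)) => i.
rewrite range_enum_val; apply: Wf; rewrite We.
by apply: lspan_gen; exists i.
Qed.

Lemma card_le_ldim W (I : finType) (e : I -> V) :
  fin_dim W -> indep e -> (forall i, W (e i)) -> (#|I| <= ldim W)%N.
Proof.
move=> /ldimP [f [_ Wf]] ie We.
by apply: (steinitz (indep_enum ie) (f := f)) => i; rewrite -Wf; exact: We.
Qed.

(** If [v] were outside the span, [v] and [e] together would be independent. *)
Lemma maximal_indep_span W d (e : 'I_d -> V) : lin_indep e ->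
  (forall (f : 'I_d.+1 -> V), (forall i, W (f i)) -> ~ lin_indep f) ->
  (forall i, W (e i)) -> W `<=` lspan (range e).
Proof.
move=> ie maxe We v Wv; apply: contrapT => nv.
pose f i := if unlift (@ord0 d) i is Some j then e j else v.
apply: (maxe f) => [i|c]; first by rewrite /f; case: unliftP.
rewrite big_ord_recl /f unlift_none.
under eq_bigr do rewrite liftK.
move=> ce; have c0 : c ord0 = 0.
  apply: contra_notP nv => /eqP c0; apply/lspan_rangeP.
  exists (fun i => - (c ord0)^-1 * c (lift ord0 i)).
  under eq_bigr do rewrite -scalerA.
  move/eqP: ce; rewrite addrC addr_eq0 -scaler_sumr => /eqP ->.
  by rewrite scalerN scaleNr opprK scalerA mulVf ?scale1r.
move: ce; rewrite c0 scale0r add0r => /ie ci i.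
by case: (unliftP ord0 i) => [j|] ->.
Qed.

(** Unlike [fin_dim], this asks neither for a subspace nor for a basis, which
    makes its stability under unions, products and spans immediate. The two are
    related by [fin_dimP]. *)
Definition fin_gen W : Prop := exists s, W `<=` lspan [set` s].

Lemma range_tnth s : range (tnth (in_tuple s)) = [set` s].
Proof.
apply/seteqP; split=> v /=; first by move=> [i _ <-]; exact: mem_tnth.
by move=> /(tnthP (in_tuple s)) [i ->]; exists i.
Qed.

(** A subspace of a finitely spanned space has independent families of bounded
    size only, and one of maximal size is a basis. *)
Lemma fin_dimP W : fin_dim W <-> lin_subspace W /\ fin_gen W.
Proof.
split=> [fW|[sW [s Ws]]].
  split; first exact: fin_dim_subspace.
  case: fW => d [e [_ ->]]; exists [seq e i | i <- enum 'I_d].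
  apply: lspan_mono => _ [i _ <-] /=; apply: map_f; exact: mem_enum.
pose P d := `[< exists e : 'I_d -> V, lin_indep e /\ forall i, W (e i) >].
have exP : exists d, P d.
  by exists 0%N; apply/asboolP; exists (fun=> 0); split=> [c _|] [].
have leP d : P d -> (d <= size s)%N.
  move=> /asboolP [e [ie We]]; apply: (steinitz ie (f := tnth (in_tuple s))) => i.
  by rewrite range_tnth; exact/Ws.
case: (ex_maxnP exP leP) => d /asboolP [e [ie We]] maxd.
exists d, e; split => //; apply/seteqP; split.
  apply: maximal_indep_span => // f Wf jf.
  have /maxd : P d.+1 by apply/asboolP; exists f.
  by rewrite ltnn.
by apply: lspan_min => // _ [i _ <-].
Qed.

Lemma fin_gen_sub S T : S `<=` T -> fin_gen T -> fin_gen S.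
Proof. by move=> ST [s Ts]; exists s; exact: subset_trans Ts. Qed.

Lemma fin_gen_lspan S : fin_gen S -> fin_gen (lspan S).
Proof.
by move=> [s Ss]; exists s; apply: lspan_min => //; exact: subspace_lspan.
Qed.

Lemma fin_gen_seq s : fin_gen [set` s].
Proof. by exists s; exact: lspan_gen. Qed.

Lemma fin_genU S T : fin_gen S -> fin_gen T -> fin_gen (S `|` T).
Proof.
move=> [s Ss] [t Tt]; exists (s ++ t) => v [/Ss|/Tt]; apply: lspan_mono => w /=;
  by rewrite mem_cat => ->; rewrite ?orbT.
Qed.

Lemma fin_gen_bigcup (I : choiceType) (r : seq I) (F : I -> set V) :
  (forall i, i \in r -> fin_gen (F i)) -> fin_gen (\bigcup_(i in [set` r]) F i).
Proof.
elim: r => [_|i r IH fF]; first by exists [::] => v [].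
apply: (fin_gen_sub (T := F i `|` \bigcup_(j in [set` r]) F j)).
  move=> v [j /=]; rewrite in_cons => /orP [/eqP -> ?|jr ?]; first by left.
  by right; exists j.
apply: fin_genU; first by apply: fF; rewrite mem_head.
by apply: IH => j jr; apply: fF; rewrite in_cons jr orbT.
Qed.

Lemma fin_dim_lspan S : fin_gen S -> fin_dim (lspan S).
Proof.
by move=> fS; apply/fin_dimP; split; [exact: subspace_lspan|exact: fin_gen_lspan].
Qed.

End Subspaces.

(** * Powers and growth of a subspace of an algebra *)

Lemma subspace_preim (k : fieldType) (U V : lmodType k) (f : {linear U -> V})
  (W : set V) : lin_subspace W -> lin_subspace [set u | W (f u)].
Proof.
move=> sW; apply: subspaceP => /= [|c u v Wu Wv].
  by rewrite linear0; apply: sW; exact: lspan0.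
by rewrite linearP; apply: sW; apply: lspan_lin; exact: lspan_gen.
Qed.

Section PowersOfSubspaces.
Context (k : fieldType) (A : algType k).
Implicit Types (S T U V W : set A) (x y z : A).

Lemma lmul_mem S T x y : S x -> T y -> lmul S T (x * y).
Proof. by move=> Sx Ty; apply: lspan_gen; exists x, y. Qed.

Lemma lmul_min S T U : lin_subspace U -> (forall x y, S x -> T y -> U (x * y)) ->
  lmul S T `<=` U.
Proof.
by move=> sU STU; apply: lspan_min => // _ [x [y [Sx Ty ->]]]; exact: STU.
Qed.

(** [lmul] spans the products of members of [S] and [T]; by bilinearity it
    also contains the products of members of their spans. *)
Lemma lmul_lspan S T x y : lspan S x -> lspan T y -> lmul S T (x * y).
Proof.
move=> [m [c [w [Sw ->]]]] [l [b [v [Tv ->]]]].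
rewrite mulr_suml; apply: lspan_sum => i _.
rewrite mulr_sumr; apply: lspan_sum => j _.
by rewrite -scalerAl -scalerAr; do 2 apply: lspanZ; exact: lmul_mem.
Qed.

Lemma fin_gen_lmul S T : fin_gen S -> fin_gen T -> fin_gen (lmul S T).
Proof.
move=> [s Ss] [t Tt]; exists [seq x * y | x <- s, y <- t].
apply: lmul_min; first exact: subspace_lspan.
move=> x y /Ss xs /Tt yt; have := lmul_lspan xs yt.
apply: lspan_mono => _ [u [v [us vt ->]]] /=.
by apply/allpairsP; exists (u, v).
Qed.

Lemma subspace_lpow V m : lin_subspace (lpow V m).
Proof. by case: m => [|m]; exact: subspace_lspan. Qed.

Lemma fin_gen_lpow V m : fin_gen V -> fin_gen (lpow V m).
Proof.
move=> fV; elim: m => [|m IH]; last exact: fin_gen_lmul.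
apply: fin_gen_lspan; apply: fin_gen_sub (fin_gen_seq [:: 1]) => x -> /=.
by rewrite inE.
Qed.

Lemma lpow0_1 V : lpow V 0 1.
Proof. exact: lspan_gen. Qed.

Lemma lpowD V i j x y : lpow V i x -> lpow V j y -> lpow V (i + j) (x * y).
Proof.
move=> + Vy; elim: i x => [|i IH] x.
  apply: (lspan_min (W := [set x | lpow V j (x * y)])) => [|_ ->]; last first.
    by rewrite /= mul1r.
  apply: subspaceP => /= [|c u v Vu Vv].
    by rewrite mul0r; apply: (subspace_lpow (V := V)); exact: lspan0.
  rewrite mulrDl -scalerAl; apply: (subspace_lpow (V := V)).
  by apply: lspan_lin; exact: lspan_gen.
pose U := [set x | lpow V (i.+1 + j) (x * y)].
apply: (lmul_min (U := U)) => [|u v Vu Vv]; rewrite /U /=; last first.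
  by rewrite -mulrA; apply: lmul_mem => //; exact: IH.
apply: subspaceP => /= [|c u v Vu Vv]; first by rewrite mul0r; exact: lspan0.
by rewrite mulrDl -scalerAl; exact: lspan_lin.
Qed.

Lemma lpow1 V x : V x -> lpow V 1 x.
Proof. by move=> Vx; rewrite -[x]mulr1; apply: lmul_mem => //; exact: lpow0_1. Qed.

Lemma lpow_le V i j : V 1 -> (i <= j)%N -> lpow V i `<=` lpow V j.
Proof.
move=> V1 /subnK <- x Vx; elim: (j - i)%N => // d IH.
by rewrite addSn -[x]mul1r; exact: lmul_mem.
Qed.

Lemma lpow_lgrow V m : lpow V m `<=` lgrow V m.
Proof. by move=> x Vx; apply: lspan_gen; exists m => /=. Qed.

Lemma fin_dim_lgrow V m : fin_gen V -> fin_dim (lgrow V m).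
Proof.
move=> fV; apply: fin_dim_lspan.
apply: (fin_gen_sub (T := \bigcup_(j in [set` iota 0 m.+1]) lpow V j)).
  by move=> x [j jm Vx]; exists j => //; rewrite /mkset mem_iota add0n ltnS.
by apply: fin_gen_bigcup => j _; exact: fin_gen_lpow.
Qed.

Lemma ldim_lgrow_gt0 V m : fin_gen V -> (0 < ldim (lgrow V m))%N.
Proof.
move=> fV; rewrite -(card_ord 1).
apply: (card_le_ldim (e := fun=> 1)); first exact: fin_dim_lgrow.
  move=> c; rewrite big_ord1 => /eqP.
  by rewrite scaler_eq0 oner_eq0 orbF => /eqP c0 i; rewrite ord1.
by move=> _; apply: lspan_gen; exists 0%N => //; exact: lpow0_1.
Qed.

End PowersOfSubspaces.

Lemma lpow_morph (k : fieldType) (A B : algType k) (f : {lrmorphism A -> B})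
    (V : set A) (W : set B) m x :
  (forall v, V v -> W (f v)) -> lpow V m x -> lpow W m (f x).
Proof.
move=> VW; elim: m x => [|m IH] x.
  apply: (lspan_min (W := [set x | lpow W 0 (f x)])).
    by apply: (subspace_preim (f := f)); exact: subspace_lpow.
  by move=> _ -> /=; rewrite rmorph1; exact: lpow0_1.
apply: (lmul_min (U := [set x | lpow W m.+1 (f x)])).
  by apply: (subspace_preim (f := f)); exact: subspace_lpow.
by move=> u v Vu Vv /=; rewrite rmorphM; apply: lmul_mem; [exact: VW|exact: IH].
Qed.

(** * Stable subspaces of locally algebraic automorphisms *)

Section StableSubspaces.
Context (k : fieldType) (A : algType k).
Implicit Types (s u : algAut A) (W : set A) (x y : A).

Definition stable s W : Prop := forall w, W w -> W (s w).

(** An injective endomorphism of a finite-dimensional space is onto. *)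
Lemma stable_inv s W w : fin_dim W -> stable s W -> W w -> W (aut_inv s w).
Proof.
move=> fW sW Ww; have [e [ie We _]] := ldim_basis fW.
have ise : lin_indep (s \o e).
  move=> c; under eq_bigr do rewrite -linearZ.
  rewrite -linear_sum -[X in _ = X -> _](rmorph0 s).
  by move=> /(can_inj (aut_funK s)) /ie.
have : lspan (range (s \o e)) w.
  apply: maximal_indep_span Ww => // [f Wf jf|i]; last exact/sW.
  by have := card_le_ldim fW (jf : indep f) Wf; rewrite card_ord ltnn.
move=> /lspan_rangeP [c ->]; under eq_bigr do rewrite -linearZ.
rewrite -linear_sum aut_funK; apply: (fin_dim_subspace fW).
by apply: lspan_sum => i _; exact/lspanZ/lspan_gen.
Qed.

Lemma stable_autz s W z w : fin_dim W -> stable s W -> W w -> W (autz s z w).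
Proof.
move=> fW sW Ww; case: z => m /=; first by elim: m => //= m; exact: sW.
by elim: m => [|m IH]; apply: stable_inv.
Qed.

Definition orbit_span s W : set A := lspan (\bigcup_(m : nat) (autz s m @` W)).

Lemma sub_orbit_span s W : W `<=` orbit_span s W.
Proof. by move=> w Ww; apply: lspan_gen; exists 0%N => //; exists w. Qed.

(** Since [u] commutes with [s], saturating under [s] does not spoil the
    stability already achieved for [u]. *)
Lemma stable_orbit_span s u W : (forall x, u (s x) = s (u x)) ->
  stable u W -> stable u (orbit_span s W).
Proof.
move=> us uW; have sub : lin_subspace [set x | orbit_span s W (u x)].
  by apply: (subspace_preim (f := u)); exact: subspace_lspan.
apply: (lspan_min sub) => _ [m _ [w Ww <-]] /=.
apply: lspan_gen; exists m => //; exists (u w); first exact: uW.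
by elim: (m) => //= l ->; rewrite us.
Qed.

Lemma orbit_span_stable s W : stable s (orbit_span s W).
Proof.
have sub : lin_subspace [set x | orbit_span s W (s x)].
  by apply: (subspace_preim (f := s)); exact: subspace_lspan.
apply: (lspan_min sub) => _ [m _ [w Ww <-]] /=.
by apply: lspan_gen; exists m.+1 => //; exists w.
Qed.

(** The orbit of each of the finitely many generators of [W] stays in a
    finite-dimensional space. *)
Lemma fin_gen_orbit_span s W :
  locally_algebraic s -> fin_gen W -> fin_gen (orbit_span s W).
Proof.
move=> /choice [F FP] [t Wt]; apply: fin_gen_lspan.
pose U := \bigcup_(w in [set` t]) F w.
have fU : fin_gen U.
  by apply: fin_gen_bigcup => w _; have [/fin_dimP []] := FP w.
apply: fin_gen_sub (fin_gen_lspan fU) => _ [m _ [w /Wt [l [c [v [tv ->]]]] <-]].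
have [f fE] := autzP s m; rewrite fE linear_sum.
apply: lspan_sum => i _; rewrite linearZ /= -fE; apply/lspanZ/lspan_gen.
by exists (v i); [exact: tv|have [_] := FP (v i)].
Qed.

(** Saturate under one automorphism after the other. Forward orbits are enough,
    as [stable_inv] recovers the inverses. *)
Lemma stable_hull (n : nat) (s : 'I_n -> algAut A) W :
    (forall i j x, s i (s j x) = s j (s i x)) ->
    (forall i, locally_algebraic (s i)) -> fin_gen W ->
  exists W', [/\ fin_dim W', W `<=` W' & forall i, stable (s i) W'].
Proof.
move=> sC sA fW.
suff [W' [fW' WW' sW']] : exists W', [/\ fin_gen W', W `<=` W' &
    forall i, i \in enum 'I_n -> stable (s i) W'].
  have sW i : stable (s i) (lspan W').
    have sub := subspace_preim (f := s i) (subspace_lspan (S := W')).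
    apply: (lspan_min sub) => w /=; rewrite /mkset => Ww.
    by apply: lspan_gen; apply: sW' Ww; rewrite mem_enum.
  exists (lspan W'); split => //; first exact: fin_dim_lspan.
  by move=> w /WW'; exact: lspan_gen.
elim: (enum _) => [|i r [W' [fW' WW' sW']]].
  by exists W; split => // i; rewrite in_nil.
exists (orbit_span (s i) W'); split; first exact: fin_gen_orbit_span.
  exact: subset_trans (sub_orbit_span (s i) (W := W')).
move=> j; rewrite in_cons => /orP [/eqP ->|jr]; first exact: orbit_span_stable.
by apply: stable_orbit_span => [x|]; [exact: sC|exact: sW'].
Qed.

End StableSubspaces.

(** * Upper bound on the growth of subspaces of the skew Laurent ring *)

Section UpperBound.
Context (k : fieldType) (R : algType k) (n : nat) (D : skew_data R n).
Local Notation Zn := {ffun 'I_n -> int}.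
Local Notation L := (skewLaurent D).
Implicit Types (W : set R) (V : set L) (f g : L) (a b : Zn).

Lemma sigmaz_stable W a w : fin_dim W -> (forall i, stable (sigma D i) W) ->
  W w -> W (sigmaz D a w).
Proof.
move=> fW sW Ww; rewrite /sigmaz; elim: (index_enum _) => [|i r IH].
  by rewrite big_nil.
by rewrite big_cons /=; exact: stable_autz.
Qed.

(** A filtration of the skew Laurent ring by the growth of the coefficients and
    the size of the exponents at once; [d] bounds the exponents occurring in a
    generating space. *)
Definition box (d j : nat) W : set L :=
  [set f | forall a, lpow W j (coef f a) /\
                     (coef f a != 0 -> forall i, (`|a i| <= d * j)%N)].

Lemma subspace_box d j W : lin_subspace (box d j W).
Proof.
apply: subspaceP => [a|c f g Ff Fg a].
  rewrite Defs.coef0 eqxx; split => //; apply: (@subspace_lpow _ _ W).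
  exact: lspan0.
have [Wf bf] := Ff a; have [Wg bg] := Fg a; rewrite Defs.coefD Defs.coefZ; split.
  apply: (@subspace_lpow _ _ W).
  by apply: lspan_lin; exact: lspan_gen.
have [fa|/bf //] := eqVneq (coef f a) 0.
by rewrite fa scaler0 add0r.
Qed.

Lemma box_mono d j W a r : lpow W j r -> (forall i, (`|a i| <= d * j)%N) ->
  box d j W (mono D a r).
Proof.
move=> Wr ad b; rewrite coef_mono; case: eqP => [->//|_].
rewrite eqxx; split => //; apply: (@subspace_lpow _ _ W).
exact: lspan0.
Qed.

(** In [(f_a t^a)(g_b t^b)] the coefficient becomes a multiple of
    [f_a sigma^a(g_b)], and [sigma^a] preserves the powers of [W]. *)
Lemma box_mul d i j W f g : fin_dim W -> (forall i, stable (sigma D i) W) ->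
  box d i W f -> box d j W g -> box d (i + j) W (f * g).
Proof.
move=> fW sW Ff Fg.
have -> : f * g = \sum_(a <- supp f) \sum_(b <- supp g)
  mono D (a + b) (cocycle D a b *: (coef f a * sigmaz D a (coef g b))) by [].
rewrite big_seq; apply: subspace_sum => [|a]; first exact: subspace_box.
rewrite mem_supp => fa; have [Wf /(_ fa) bf] := Ff a.
rewrite big_seq; apply: subspace_sum => [|b]; first exact: subspace_box.
rewrite mem_supp => gb; have [Wg /(_ gb) bg] := Fg b.
apply: box_mono => [|l]; last first.
  have absD (x y : int) : (`|(x + y)%R| <= `|x| + `|y|)%N by lia.
  rewrite ffunE mulnDr; apply: leq_trans (absD _ _) _.
  exact: leq_add (bf l) (bg l).
apply: (@subspace_lpow _ _ W); apply/lspanZ/lspan_gen/lpowD => //.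
have [F FE] := sigmazP D a; rewrite FE; apply: lpow_morph Wg => w Ww.
by rewrite -FE; exact: sigmaz_stable.
Qed.

Lemma box_le d i j W : W 1 -> (i <= j)%N -> box d i W `<=` box d j W.
Proof.
move=> W1 ij f Ff a; have [Wf bf] := Ff a; split; first exact: lpow_le Wf.
move=> /bf fa l; apply: leq_trans (fa l) _; by rewrite leq_mul2l ij orbT.
Qed.

Lemma lgrow_box d V W m : fin_dim W -> W 1 ->
  (forall i, stable (sigma D i) W) -> V `<=` box d 1 W ->
  lgrow V m `<=` box d m W.
Proof.
move=> fW W1 sW VW; apply: lspan_min; first exact: subspace_box.
move=> f [j /= jm Vf]; apply: (box_le W1 jm).
elim: j f {jm} Vf => [|j IH] f.
  apply: lspan_min; first exact: subspace_box.
  move=> _ ->; apply: box_mono => [|i]; first exact: lpow0_1.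
  by rewrite ffunE.
apply: lmul_min; first exact: subspace_box.
by move=> x y /VW Fx /IH Fy; exact: (@box_mul d 1 j).
Qed.

(** The points of the cube of half-width [N] are counted by shifting them to
    the cube with side [0, ..., 2N]. *)
Lemma box_span d j W : fin_gen W ->
  exists (I : finType) (f : I -> L), box d j W `<=` lspan (range f) /\
    #|I| = ((2 * (d * j)).+1 ^ n * ldim (lgrow W j))%N.
Proof.
move=> fW; have [e [_ _ We]] := ldim_basis (fin_dim_lgrow j fW).
set N := (d * j)%N.
exists ({ffun 'I_n -> 'I_(2 * N).+1} * 'I_(ldim (lgrow W j)))%type.
exists (fun p : {ffun 'I_n -> 'I_(2 * N).+1} * 'I_(ldim (lgrow W j)) =>
  mono D [ffun i => (p.1 i)%:Z - N%:Z] (e p.2)).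
split; last by rewrite card_prod card_ffun !card_ord.
move=> f Ff; rewrite (sl_expand f) big_seq; apply: lspan_sum => a.
rewrite mem_supp => fa; have [Wf /(_ fa) bf] := Ff a.
have [c ->] := We _ (lpow_lgrow Wf).
rewrite (big_morph (mono D a) (monoD D a) (mono0 D a)).
apply: lspan_sum => i _; rewrite monoZ; apply/lspanZ/lspan_gen.
exists ([ffun l => inord `|(a l + N%:Z)%R|%N], i) => //=.
congr mono; apply/ffunP => l; rewrite !ffunE.
have shift (x : int) : (`|x| <= N)%N ->
    (`|(x + N%:Z)%R| < (2 * N).+1)%N /\ `|(x + N%:Z)%R|%N%:Z - N%:Z = x by lia.
by have [lt eq] := shift _ (bf l); rewrite inordK.
Qed.

(** Stated for all subspaces [W'] above [W] so that [W'] can be taken stable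
    under the automorphisms. *)
Lemma fin_gen_coefs V : fin_gen V -> exists (W : set R) (d : nat),
  [/\ fin_gen W, W 1 &
      forall W', W `<=` W' -> lin_subspace W' -> V `<=` box d 1 W'].
Proof.
move=> [s Vs]; pose cs := [seq coef f a | f <- s, a <- supp f].
pose ds := [seq \max_(i < n) `|a i|%N | f <- s, a <- supp f].
exists [set` 1 :: cs], (\max_(x <- ds) x).
split => [||W' WW' sW']; [exact: fin_gen_seq|exact: mem_head|].
apply: subset_trans Vs _; apply: lspan_min; first exact: subspace_box.
move=> f /= sf a; split.
  have [->|fa] := eqVneq (coef f a) 0.
    by apply: (@subspace_lpow _ _ W'); exact: lspan0.
  apply/lpow1/WW' => /=; rewrite in_cons; apply/orP; right.
  by apply: allpairs_f_dep => //; rewrite mem_supp.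
move=> fa i; rewrite muln1.
apply: leq_trans (leq_bigmax (F := fun i => `|a i|%N) i) _.
apply: (leq_bigmax_seq (F := id)) => //.
by apply/allpairsPdep; exists f, a; rewrite mem_supp.
Qed.

(** The automorphisms map the coefficient space [W] to itself, so multiplying
    [m] elements of [V] costs one factor [W] each and moves the exponents by a
    bounded amount each: the growth of [V] is at most that of [W] times the
    number of lattice points of a cube of side [O(m)]. *)
Lemma upper_growth V : (forall i, locally_algebraic (sigma D i)) ->
  fin_dim V -> exists (W : set R) (C : nat), fin_dim W /\ forall m, (0 < m)%N ->
    (ldim (lgrow V m) <= (C.+1 * m) ^ n * ldim (lgrow W m))%N.
Proof.
move=> sA /fin_dimP [_ /fin_gen_coefs [W0 [d [fW0 W01 VW0]]]].
have [W [fW W0W sW]] := stable_hull (@sigma_comm _ _ _ D) sA fW0.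
have [sub gW] := (fin_dimP W).1 fW.
exists W, (2 * d)%N; split => // m m0.
have [I [f [If cI]]] := box_span d m gW.
apply: leq_trans (ldim_le_card (f := f) _) _.
  apply: subset_trans If; apply: lgrow_box => //; first exact: W0W.
  exact: VW0.
have powle (l x y : nat) : (x <= y)%N -> (x ^ l <= y ^ l)%N.
  by case: l => // l; rewrite leq_exp2r.
by rewrite cI leq_mul2r; apply/orP; right; apply: powle; lia.
Qed.

End UpperBound.

(** * Lower bound from monomials with regular coefficients *)

Section LowerBound.
Context (k : fieldType) (R : algType k) (n : nat) (D : skew_data R n).
Local Notation Zn := {ffun 'I_n -> int}.
Local Notation L := (skewLaurent D).
Implicit Types (W : set R) (V : set L) (f g : L) (a b : Zn) (r s : R).

Lemma sl_constP : exists F : {lrmorphism R -> L}, sl_const D =1 F.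
Proof.
have lin : linear (sl_const D) by move=> c x y; rewrite sl_constD sl_constZ.
have mul : monoid_morphism (sl_const D).
  by split; [exact: sl_const1|exact: sl_constM].
pose fl := GRing.isLinear.Build k R L *:%R (sl_const D) lin.
pose fm := GRing.isMonoidMorphism.Build R L (sl_const D) mul.
pose F : {lrmorphism R -> L} := HB.pack (sl_const D) fl fm.
by exists F.
Qed.

Lemma lgrow_sl_const V W m : V 1 -> (forall w, W w -> V (sl_const D w)) ->
  forall w, lgrow W m w -> lpow V m (sl_const D w).
Proof.
move=> V1 WV; have [F FE] := sl_constP.
have sub := subspace_preim (f := F) (@subspace_lpow _ _ V m).
move=> w Ww; rewrite FE; apply: (lspan_min sub) Ww => x [j /= jm Wx].
apply: (lpow_le V1 jm); apply: lpow_morph Wx => v.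
by rewrite -FE; exact: WV.
Qed.

Lemma sl_const_mono r a s : sl_const D r * mono D a s = mono D a (r * s).
Proof. by rewrite mulmonoE add0r cocycle0l scale1r sigmaz0. Qed.

(** Monomials of distinct degrees whose coefficients are right regular are
    linearly independent over [R] acting on the left; multiplying them by a
    basis of [lgrow W m] gives an independent family in [lgrow V (m + q)]. *)
Lemma card_monomials_le V W m q (T : finType) (a : T -> Zn) (r : T -> R) :
    fin_gen V -> V 1 -> fin_gen W -> (forall w, W w -> V (sl_const D w)) ->
    injective a -> (forall t, GRing.rreg (r t)) ->
    (forall t, lpow V q (mono D (a t) (r t))) ->
  (#|T| * ldim (lgrow W m) <= ldim (lgrow V (m + q)))%N.
Proof.
move=> fV V1 fW WV inja regr Vr.
have [e [ie We _]] := ldim_basis (fin_dim_lgrow m fW).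
rewrite -[X in (_ * X)%N]card_ord -card_prod.
pose y (p : T * 'I_(ldim (lgrow W m))) := mono D (a p.1) (e p.2 * r p.1).
apply: (card_le_ldim (e := y)) => [|c|[t i]]; first exact: fin_dim_lgrow.
  (* Comparing coefficients in degree [a t] isolates the terms with index [t],
     and [r t] can be cancelled on the right. *)
  move=> c0 [t i]; pose d j := c (t, j).
  apply: (ie d); apply: (regr t); rewrite mul0r mulr_suml.
  have := congr1 (fun f => coef f (a t)) c0.
  rewrite Defs.coef0 Defs.coef_sum; apply: etrans.
  have -> : \sum_p coef (c p *: y p) (a t) =
      \sum_u \sum_j coef (c (u, j) *: y (u, j)) (a t).
    by rewrite pair_bigA; apply: eq_bigr => -[].
  rewrite (bigD1 t) //= [X in _ + X]big1 ?addr0 => [|u ut].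
    by apply: eq_bigr => j _; rewrite Defs.coefZ coef_mono eqxx scalerAl.
  apply: big1 => j _; rewrite Defs.coefZ coef_mono /=.
  by rewrite (inj_eq inja) eq_sym (negbTE ut) scaler0.
rewrite /y -sl_const_mono; apply/lpow_lgrow/lpowD => //.
exact: (lgrow_sl_const V1 WV).
Qed.

Lemma sigmazK a : cancel (sigmaz D a) (sigmaz D (- a)).
Proof. by move=> x; rewrite -sigmazD addNr sigmaz0. Qed.

Lemma rreg_sigmaz a r : GRing.rreg r -> GRing.rreg (sigmaz D a r).
Proof.
move=> reg x y; rewrite -[x](sigmazK (- a)) -[y](sigmazK (- a)) opprK.
by rewrite -!sigmaz_mul => /(can_inj (sigmazK a)) /reg ->.
Qed.

Lemma cocycle_neq0 a b : cocycle D a b != 0.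
Proof.
apply/prodf_neq0 => i _; apply/prodf_neq0 => j _.
exact/expfz_neq0/pmat_neq0.
Qed.

Definition regular_mono a f : Prop := exists r, GRing.rreg r /\ f = mono D a r.

Lemma regular_mono1 : regular_mono 0 1.
Proof. by exists 1; split => // x y; rewrite !mulr1. Qed.

Lemma regular_monoM a b f g : regular_mono a f -> regular_mono b g ->
  regular_mono (a + b) (f * g).
Proof.
move=> [r [rr ->]] [s [rs ->]]; rewrite mulmonoE; eexists; split; last by [].
move=> x y; rewrite -!scalerAr => /(scalerI (cocycle_neq0 a b)).
by rewrite !mulrA => /(rreg_sigmaz rs) /rr.
Qed.

Lemma regular_mono_prod (I : Type) (t : seq I) (a : I -> Zn) (x : I -> L)
    (e : I -> nat) : (forall i, regular_mono (a i) (x i)) ->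
  regular_mono (\sum_(i <- t) a i *+ e i) (\prod_(i <- t) x i ^+ e i).
Proof.
move=> ax; elim: t => [|i t IH]; first by rewrite !big_nil; exact: regular_mono1.
rewrite !big_cons; apply: regular_monoM IH; elim: (e i) => [|l IH].
  by rewrite mulr0n expr0; exact: regular_mono1.
by rewrite mulrS exprS; exact: regular_monoM.
Qed.

Lemma lpow_prod V (I : Type) (t : seq I) (x : I -> L) (e : I -> nat) :
  (forall i, V (x i)) ->
  lpow V (\sum_(i <- t) e i)%N (\prod_(i <- t) x i ^+ e i).
Proof.
move=> Vx; elim: t => [|i t IH]; first by rewrite !big_nil; exact: lpow0_1.
rewrite !big_cons; apply: lpowD IH; elim: (e i) => [|l IH].
  by rewrite expr0; exact: lpow0_1.
by rewrite exprS; exact: lmul_mem.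
Qed.

(** The products [x_1^(e_1) ... x_n^(e_n)] with all exponents below [m] have
    [m^n] different degrees. *)
Lemma growth_with_monomials V W (z : int) (x : 'I_n -> L) :
    fin_gen V -> V 1 -> fin_gen W -> (forall w, W w -> V (sl_const D w)) ->
    z != 0 -> (forall i, V (x i)) ->
    (forall i, regular_mono (ebase i z) (x i)) ->
  forall m, (m ^ n * ldim (lgrow W m) <= ldim (lgrow V (n.+1 * m)))%N.
Proof.
move=> fV V1 fW WV z0 Vx xr m.
pose a (e : {ffun 'I_n -> 'I_m}) := \sum_(i < n) ebase i z *+ (e i : nat).
have /choice [r rP] (e : {ffun 'I_n -> 'I_m}) :=
  regular_mono_prod (index_enum 'I_n) (fun i => e i : nat) xr.
have -> : (m ^ n)%N = #|{ffun 'I_n -> 'I_m}| by rewrite card_ffun !card_ord.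
rewrite mulSn; apply: (card_monomials_le m fV V1 fW WV (a := a) (r := r)).
- move=> e e' ee'; apply/ffunP => i; apply/val_inj => /=.
  have := congr1 (fun b : Zn => b i) ee'.
  have aE (e0 : {ffun 'I_n -> 'I_m}) : a e0 i = z *+ (e0 i : nat).
    rewrite /a sum_ffunE (bigD1 i) //= big1 ?addr0 => [|j ji].
      by rewrite ffunMnE ffunE eqxx.
    by rewrite ffunMnE ffunE eq_sym (negbTE ji) mul0rn.
  rewrite !aE -[LHS]mulr_natr -[RHS]mulr_natr => /(mulfI z0) /eqP.
  by rewrite eqr_nat => /eqP.
- by move=> e; have [] := rP e.
move=> e; have [_ <-] := rP e; apply: (lpow_le V1) (lpow_prod _ _ Vx).
have -> : (n * m)%N = (\sum_(i < n) m)%N by rewrite sum_nat_const card_ord.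
by apply: leq_sum => i _; exact: ltnW.
Qed.

End LowerBound.

(** * Growth rates *)

Section GrowthRates.
Context (Rr : realType).
Implicit Types (u : nat -> Rr) (F G : nat -> nat).

Lemma limn_esup_le u (x : Rr) :
  (forall e, 0 < e -> \forall m \near \oo, u m <= x + e) ->
  (limn_esup (fun m => (u m)%:E) <= x%:E)%E.
Proof.
move=> ux; apply/lee_addgt0Pr => e e0; rewrite -EFinD.
pose U := [set m | u m <= x + e].
apply: ge_ereal_inf; exists (ereal_sup ((fun m => (u m)%:E) @` U)).
  by exists U => //; exact: ux.
by apply: ge_ereal_sup => _ [m /= um <-]; rewrite lee_fin.
Qed.

Lemma limn_esup_lt u (x : Rr) :
  (limn_esup (fun m => (u m)%:E) < x%:E)%E -> \forall m \near \oo, u m < x.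
Proof.
move=> /ereal_inf_lt [_ [U Uoo <-] Ux]; apply: filterS Uoo => m Um.
rewrite -lte_fin; apply: le_lt_trans Ux; apply: ereal_sup_ubound.
by exists m.
Qed.

Lemma near_ln_ge (c : Rr) : \forall m \near \oo, c <= ln (m%:R : Rr).
Proof.
near=> m.
have cm : expR c <= m%:R by near: m; exact: nbhs_infty_ger.
rewrite -[c]expRK ler_ln ?posrE ?expR_gt0 //.
exact: lt_le_trans (expR_gt0 c) cm.
Unshelve. all: by end_near. Qed.

Definition growth_rate F : \bar Rr :=
  limn_esup (fun m => (ln ((F m)%:R : Rr) / ln (m%:R : Rr))%:E).

Lemma ln_nat_ge0 (m : nat) : 0 <= ln (m%:R : Rr).
Proof.
case: m => [|m]; first by rewrite ln0.
by apply: ln_ge0; rewrite ler1n.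
Qed.

Lemma growth_rate_ge0 F : (0 <= growth_rate F)%E.
Proof.
apply: limf_esup_ge0 => [[N _ NF]|m]; first exact: (NF N (leqnn N)).
by rewrite lee_fin divr_ge0 ?ln_nat_ge0.
Qed.

(** After division by [ln m], the factor [(C + 1)^n] contributes
    [n ln (C + 1) / ln m], which is eventually at most [e / 2]. *)
Lemma growth_rate_upper F G n C : (forall m, 0 < F m)%N ->
  (forall m, (0 < m)%N -> (G m <= (C.+1 * m) ^ n * F m)%N) ->
  (growth_rate G <= growth_rate F + n%:R%:E)%E.
Proof.
move=> F0 GF; have := growth_rate_ge0 F.
case rF : (growth_rate F) => [x| |] //; last by rewrite addye // !leey.
rewrite lee_fin => x0; rewrite -EFinD; apply: limn_esup_le => e e0.
near=> m.
have lm0 : 0 < ln (m%:R : Rr).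
  by apply: lt_le_trans (ltr01) _; near: m; exact: near_ln_ge.
have m0 : (0 < m)%N by rewrite lt0n; apply: contraTneq lm0 => ->; rewrite ln0 ?ltxx.
have Fm : ln ((F m)%:R : Rr) / ln (m%:R : Rr) < x + e / 2.
  near: m; apply: limn_esup_lt; rewrite -/(growth_rate F) rF lte_fin; lra.
have Cm : n%:R * ln (C.+1%:R : Rr) / (e / 2) <= ln (m%:R : Rr).
  by near: m; exact: near_ln_ge.
rewrite ltr_pdivrMr // in Fm; rewrite ler_pdivrMr ?divr_gt0 // in Cm.
rewrite ler_pdivrMr //.
apply: (@le_trans _ _ (ln (((C.+1 * m) ^ n * F m)%N%:R : Rr))).
  have [->|Gm] := posnP (G m); first by rewrite ln0 ?ln_nat_ge0.
  by rewrite ler_ln ?posrE ?ltr0n ?ler_nat ?GF // (leq_trans Gm) ?GF.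
rewrite natrM natrX natrM lnM ?posrE ?exprn_gt0 ?mulr_gt0 ?ltr0n //.
rewrite lnXn ?mulr_gt0 ?ltr0n // lnM ?posrE ?ltr0n // -[_ *+ n]mulr_natl.
lra.
Unshelve. all: by end_near. Qed.

(** [G] is only controlled along the multiples of [q + 1]. If [y] is the rate of
    [G], the change of variable costs about [y ln (q + 1) / ln m], which tends
    to [0]; this uses that [y] is finite, and there is nothing to prove when it
    is not. *)
Lemma growth_rate_lower F G n q : (forall m, 0 < F m)%N ->
  (forall m, (m ^ n * F m <= G (q.+1 * m))%N) ->
  (growth_rate F + n%:R%:E <= growth_rate G)%E.
Proof.
move=> F0 FG; have := growth_rate_ge0 G.
case rG : (growth_rate G) => [y| |] //; last by rewrite !leey.
rewrite lee_fin => y0; rewrite -leeBrDr // -EFinB.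
apply: limn_esup_le => e e0.
have e2 : 0 < y + e / 2 by lra.
have [N _ NG] : \forall m \near \oo,
    ln ((G m)%:R : Rr) / ln (m%:R : Rr) < y + e / 2.
  by apply: limn_esup_lt; rewrite -/(growth_rate G) rG lte_fin; lra.
near=> m.
have lm0 : 0 < ln (m%:R : Rr).
  by apply: lt_le_trans (ltr01) _; near: m; exact: near_ln_ge.
have m0 : (0 < m)%N by rewrite lt0n; apply: contraTneq lm0 => ->; rewrite ln0 ?ltxx.
have Nm : (N <= q.+1 * m)%N.
  by apply: (@leq_trans m); [near: m; exact: nbhs_infty_ge|rewrite leq_pmull].
have Cm : (y + e / 2) * ln (q.+1%:R : Rr) / (e / 2) <= ln (m%:R : Rr).
  by near: m; exact: near_ln_ge.
rewrite ler_pdivrMr ?divr_gt0 // in Cm.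
have lqm : ln ((q.+1 * m)%N%:R : Rr) = ln q.+1%:R + ln m%:R.
  by rewrite natrM lnM ?posrE ?ltr0n.
have := NG _ Nm; rewrite /= lqm ltr_pdivrMr; last first.
  by rewrite ltr_wpDl ?ln_nat_ge0.
have : ln ((m ^ n * F m)%N%:R : Rr) <= ln (G (q.+1 * m)%N)%:R.
  have Fm : (0 < m ^ n * F m)%N by rewrite muln_gt0 expn_gt0 m0 F0.
  by rewrite ler_ln ?posrE ?ltr0n ?ler_nat ?(leq_trans Fm).
rewrite natrM natrX lnM ?posrE ?exprn_gt0 ?ltr0n // lnXn ?ltr0n //.
rewrite -[_ *+ n]mulr_natl ler_pdivrMr //.
lra.
Unshelve. all: by end_near. Qed.

End GrowthRates.

(** * Growth of BR algebras *)

Section BRGrowth.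
Context (k : fieldType) (R : algType k) (n : nat) (D : skew_data R n).
Context (H J : 'I_n -> set R).
Local Notation L := (skewLaurent D).
Local Notation B := (BR D H J).
Implicit Types (W : set R) (V : set L) (r : R).

(** A product of sets contains the products of their members. Putting [1] in the
    places where the set is the whole ring, one obtains members of
    [I_1^(a_1) ... I_n^(a_n)] from a member of a single factor. *)
Lemma big_lmul_mem (I : Type) (s : seq I) (F : I -> set R) (x : I -> R) :
  (forall i, F i (x i)) ->
  (\big[@lmul k R/setT]_(i <- s) F i) (\prod_(i <- s) x i).
Proof.
move=> Fx; elim: s => [|i s IH]; first by rewrite !big_nil.
by rewrite !big_cons; exact: lmul_mem.
Qed.

Lemma BRfactor0_1 i : BRfactor D H J i 0 1.
Proof. by rewrite /BRfactor /= big_ord0. Qed.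

Lemma BRfactor_J i r : J i r -> BRfactor D H J i 1 r.
Proof.
move=> Jr; rewrite /BRfactor /=.
have -> : r = \prod_(j < 1) r by rewrite big_ord1.
by apply: big_lmul_mem => j; exists r; rewrite // ord1.
Qed.

Lemma BRfactor_H i r : H i r ->
  BRfactor D H J i (-1) (autz (sigma D i) (-1) r).
Proof.
move=> Hr; rewrite [BRfactor _ _ _ _ _]/BRfactor /=.
pose x (j : 'I_1) := autz (sigma D i) (- j.+1%:Z) r.
have -> : aut_inv (sigma D i) r = \prod_(j < 1) x j by rewrite big_ord1.
by apply: big_lmul_mem => j; exists r.
Qed.

Lemma BRcoef_ebase i z r : BRfactor D H J i z r ->
  BRcoef D H J (ebase i z) r.
Proof.
move=> Fr; pose x j := if j == i then r else 1.
have -> : r = \prod_(j < n) x j by rewrite -big_mkcond big_pred1_eq.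
apply: big_lmul_mem => j; rewrite ffunE /x; case: eqP => [->//|_].
exact: BRfactor0_1.
Qed.

Lemma BRcoef_0 r : BRcoef D H J 0 r.
Proof.
rewrite /BRcoef; elim: (index_enum _) => [|i s IH]; first by rewrite big_nil.
rewrite big_cons -[r]mul1r ffunE; apply: lmul_mem => //.
exact: BRfactor0_1.
Qed.

Lemma BR_mono a r : BRcoef D H J a r -> B (mono D a r).
Proof. by move=> ar; apply: lspan_gen; exists a, r; rewrite monoE. Qed.

Lemma BR_const r : B (sl_const D r).
Proof. exact/BR_mono/BRcoef_0. Qed.

Lemma fin_gen_const W : fin_gen W -> fin_gen (sl_const D @` W).
Proof.
have [F FE] := sl_constP D; move=> [s Ws]; exists [seq sl_const D w | w <- s].
move=> _ [w /Ws [m [c [v [sv ->]]]] <-]; rewrite FE linear_sum.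
apply: lspan_sum => i _; rewrite linearZ /= -FE; apply/lspanZ/lspan_gen.
exact/map_f/sv.
Qed.

Lemma BR_growth_ge_const W : fin_dim W -> exists V,
  [/\ fin_dim V, V `<=` B &
      forall m, (ldim (lgrow W m) <= ldim (lgrow V m))%N].
Proof.
move=> /fin_dimP [_ fW]; pose S : set L := (sl_const D @` W) `|` [set` [:: 1]].
have fS : fin_gen S by apply: fin_genU; [exact: fin_gen_const|exact: fin_gen_seq].
exists (lspan S); split; first exact: fin_dim_lspan.
  apply: lspan_min; first exact: subspace_lspan.
  by move=> f [[w _ <-]|/=]; [|rewrite inE => /eqP ->]; exact: BR_const.
(* The single monomial [1] serves as the family of regular monomials. *)
move=> m; rewrite -[X in (X <= _)%N]mul1n -card_unit.
rewrite -[in X in (_ <= X)%N](addn0 m).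
apply: (card_monomials_le m (a := fun=> 0) (r := fun=> 1)) => //.
- exact: fin_gen_lspan.
- by apply: lspan_gen; right; rewrite /= inE.
- by move=> w Ww; apply: lspan_gen; left; exists w.
- by move=> t u; case: t; case: u.
- by move=> _ x y; rewrite !mulr1.
- by move=> _; exact: lpow0_1.
Qed.

Lemma BR_growth_ge_monomials W (z : int) : fin_dim W -> z != 0 ->
    (forall i, exists r, GRing.rreg r /\ BRfactor D H J i z r) ->
  exists V, [/\ fin_dim V, V `<=` B & forall m,
    (m ^ n * ldim (lgrow W m) <= ldim (lgrow V (n.+1 * m)))%N].
Proof.
move=> /fin_dimP [_ fW] z0 /choice [r rP].
pose x i : L := mono D (ebase i z) (r i).
pose S : set L := (sl_const D @` W) `|` [set` 1 :: [seq x i | i <- enum 'I_n]].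
have fS : fin_gen S by apply: fin_genU; [exact: fin_gen_const|exact: fin_gen_seq].
exists (lspan S); split; first exact: fin_dim_lspan.
  apply: lspan_min; first exact: subspace_lspan.
  move=> f [[w _ <-]|/=]; first exact: BR_const.
  rewrite inE => /orP [/eqP ->|/mapP [i _ ->]]; first exact: BR_const.
  by apply/BR_mono/BRcoef_ebase; have [] := rP i.
apply: (growth_with_monomials (z := z) (x := x)) => // [||w Ww|i|i].
- exact: fin_gen_lspan.
- by apply: lspan_gen; right; rewrite /= mem_head.
- by apply: lspan_gen; left; exists w.
- by apply: lspan_gen; right; rewrite /= inE map_f ?orbT ?mem_enum.
- by exists (r i); have [] := rP i.
Qed.

End BRGrowth.

Section GKdimension.
Context (Rr : realType) (k : fieldType) (R : algType k) (n : nat).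
Context (D : skew_data R n) (H J : 'I_n -> set R).
Local Notation B := (BR D H J).

Lemma growth_rate_le_GKdim (A : algType k) (V C : set A) : fin_dim V ->
  V `<=` C -> (growth_rate Rr (fun m => ldim (lgrow V m)) <= GKdim Rr C)%E.
Proof. by move=> fV VC; apply: ereal_sup_ubound; exists V. Qed.

Lemma GKdim_BR_ge : (GKdim Rr [set: R] <= GKdim Rr B)%E.
Proof.
apply: ge_ereal_sup => _ [W [fW _] <-].
have [V [fV VB le]] := BR_growth_ge_const D H J fW.
apply: le_trans (growth_rate_le_GKdim fV VB).
have gW := ((fin_dimP W).1 fW).2.
have := @growth_rate_lower Rr (fun m => ldim (lgrow W m))
  (fun m => ldim (lgrow V m)) 0 0.
rewrite adde0; apply=> m; first exact: ldim_lgrow_gt0.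
by rewrite expn0 !mul1n.
Qed.

Lemma GKdim_BR_le : (forall i, locally_algebraic (sigma D i)) ->
  (GKdim Rr B <= GKdim Rr [set: R] + n%:R%:E)%E.
Proof.
move=> sA; apply: ge_ereal_sup => _ [V [fV _] <-].
have [W [C [fW le]]] := upper_growth sA fV.
have gW := ((fin_dimP W).1 fW).2.
apply: le_trans (growth_rate_upper Rr _ le) _ => [m|].
  exact: ldim_lgrow_gt0.
by apply: leeD2r; exact: growth_rate_le_GKdim.
Qed.

Lemma GKdim_BR_ge_add (z : int) : z != 0 ->
    (forall i, exists r, GRing.rreg r /\ BRfactor D H J i z r) ->
  (GKdim Rr [set: R] + n%:R%:E <= GKdim Rr B)%E.
Proof.
move=> z0 reg; rewrite -leeBrDr //; apply: ge_ereal_sup => _ [W [fW _] <-].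
have [V [fV VB le]] := BR_growth_ge_monomials fW z0 reg.
have gW := ((fin_dimP W).1 fW).2.
rewrite leeBrDr //; apply: le_trans (growth_rate_le_GKdim fV VB).
by apply: growth_rate_lower le => m; exact: ldim_lgrow_gt0.
Qed.

End GKdimension.

(** If [J i] were zero, so would be its product with [R]. *)
Lemma BRfactor1_neq0 (k : fieldType) (R : algType k) (n : nat)
    (D : skew_data R n) (H J : 'I_n -> set R) i : two_sided_ideal (J i) ->
  BRfactor D H J i 1 <> [set 0] -> exists2 a, J i a & a != 0.
Proof.
move=> [J0 _ _ _] F0; apply: contrapT => noJ; apply: F0.
have Jeq0 x : J i x -> x = 0.
  by move=> Jx; apply: contrapT => /eqP x0; apply: noJ; exists x.
apply/seteqP; split => [|_ ->]; last exact: BRfactor_J.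
rewrite /BRfactor /= big_ord_recl big_ord0 /=; apply: lmul_min.
  by apply: subspaceP => [//|c x y -> ->] /=; rewrite scaler0 addr0.
by move=> _ y [x /Jeq0 -> <-] _ /=; rewrite mul0r.
Qed.

Lemma commutative_domain_reg (k : fieldType) (R : algType k) (a : R) :
  commutative_domain R -> a != 0 -> GRing.rreg a.
Proof.
move=> [_ dom] a0 x y xy; apply/eqP; rewrite -subr_eq0; apply/eqP.
have [//|/eqP] : x - y = 0 \/ a = 0 by apply: dom; rewrite mulrBl xy subrr.
by rewrite (negbTE a0).
Qed.

Theorem theorem2p12 (Rr : realType) (k : fieldType) (R : algType k) (n : nat)
    (D : skew_data R n) (H J : 'I_n -> set R) (hBR : BR_axioms D H J)
    (hla : forall i : 'I_n, locally_algebraic (sigma D i)) :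
  [/\ (GKdim Rr [set: R] <= GKdim Rr (BR D H J))%E,
      (GKdim Rr (BR D H J) <= GKdim Rr [set: R] + n%:R%:E)%E,
      ((forall i : 'I_n, exists a : R,
          [/\ J i a, normal_element a & non_zero_divisor a]) \/
       (forall i : 'I_n, exists a : R,
          [/\ H i a, normal_element a & non_zero_divisor a])) ->
      GKdim Rr (BR D H J) = (GKdim Rr [set: R] + n%:R%:E)%E &
      commutative_domain R ->
      GKdim Rr (BR D H J) = (GKdim Rr [set: R] + n%:R%:E)%E].
Proof.
have upper := GKdim_BR_le Rr H J hla.
have eqJ : (forall i, exists2 a, J i a & GRing.rreg a) ->
    GKdim Rr (BR D H J) = (GKdim Rr [set: R] + n%:R%:E)%E.
  move=> regJ; apply/eqP; rewrite eq_le upper.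
  apply: (@GKdim_BR_ge_add _ _ _ _ _ _ _ 1) => // i.
  by have [a Ja ra] := regJ i; exists a; split => //; exact: BRfactor_J.
split=> // [|[nJ|nH]|dom].
- exact: GKdim_BR_ge.
- by apply: eqJ => i; have [a [Ja _ [_ ra]]] := nJ i; exists a.
- apply/eqP; rewrite eq_le upper.
  apply: (@GKdim_BR_ge_add _ _ _ _ _ _ _ (-1)) => // i.
  have [a [Ha _ [_ ra]]] := nH i.
  exists (autz (sigma D i) (-1) a); split; last exact: BRfactor_H.
  by rewrite -sigmaz_ebase; exact: rreg_sigmaz.
- apply: eqJ => i.
  have F1 : BRfactor D H J i 1 <> [set 0] by exact: BR_neq0.
  have [a Ja a0] := BRfactor1_neq0 (BR_idealJ hBR i) F1.
  by exists a => //; exact: commutative_domain_reg.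
Qed.
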